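(* Let $q$ be a prime power and let $\mathcal{U}$ be a unital of $\mathrm{PG}(2,q^2)$. Suppose that $\mathcal{U}$ is a union of irreducible conics of $\mathrm{PG}(2,q^2)$. Then $q$ is odd and $\mathcal{U}$ is a Buekenhout--Metz unital of BEHS-type, i.e. there is a non-square $t\in\mathrm{GF}(q^2)$ such that, in suitable homogeneous coordinates $(x,y,z)$ of $\mathrm{PG}(2,q^2)$ (that is, up to an element of $\mathrm{PGL}(3,q^2)$), $$\mathcal{U}=\bigcup_{a\in t\,\mathrm{GF}(q)}\mathcal{C}_a,$$ where $\mathcal{C}_a$ denotes the set of points satisfying $2yz-x^2+az^2=0$.
   Context: $\mathrm{PG}(2,q^2)$ is the Desarguesian projective plane over the finite field $\mathrm{GF}(q^2)$, where $q=p^h$ with $p$ prime. A unital in $\mathrm{PG}(2,q^2)$ is a set $\mathcal{U}$ of $q^3+1$ points such that each line of $\mathrm{PG}(2,q^2)$ meets $\mathcal{U}$ in exactly $1$ or exactly $q+1$ points. A conic is the set of points of $\mathrm{PG}(2,q^2)$ whose homogeneous coordinates satisfy a nonzero homogeneous quadratic equation over $\mathrm{GF}(q^2)$; it is irreducible if it is non-singular (for $q$ odd: if the associated symmetric $3\times 3$ matrix has rank $3$). For $q$ odd and $a\in\mathrm{GF}(q^2)$, let $\mathcal{C}_a$ be the conic with equation $2yz-x^2+az^2=0$. For a fixed non-square $t$ of $\mathrm{GF}(q^2)$ put $t\,\mathrm{GF}(q)=\{ts : s\in\mathrm{GF}(q)\}$. The set $\bigcup_{a\in t\,\mathrm{GF}(q)}\mathcal{C}_a$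 is known to be a unital of the kind constructed by Buekenhout and Metz; it is called a Buekenhout--Metz unital of Baker--Ebert--Hirschfeld--Szőnyi type (BEHS-type). *)

(* Defs.v *)
From HB Require Import structures.
From mathcomp Require Import all_boot all_order all_fingroup all_algebra.
From mathcomp Require Import mpoly.

Set Implicit Arguments.
Unset Strict Implicit.
Unset Printing Implicit Defensive.

Import GRing.Theory.
Local Open Scope ring_scope.

Section VspaceFinite.
Import VectorInternalTheory.
Variables (F : finFieldType) (vT : vectType F).
HB.instance Definition _ : isCountable {vspace vT} :=
  CanIsCountable (@vs2mxK F vT).
HB.instance Definition _ : isFinite {vspace vT} :=
  CanIsFinite (@vs2mxK F vT).
End VspaceFinite.

(* The points and lines of PG(2, F) are the 1- and 2-dimensional subspaces of
   F^3. The nonzero vectors of a point are its homogeneous coordinates. *)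
Record point (F : finFieldType) := Point {
  point_space :> {vspace 'rV[F]_3};
  _ : \dim point_space == 1%N }.
HB.instance Definition _ (F : finFieldType) := [isSub for @point_space F].
HB.instance Definition _ (F : finFieldType) := [Finite of point F by <:].

Record line (F : finFieldType) := Line {
  line_space :> {vspace 'rV[F]_3};
  _ : \dim line_space == 2%N }.

Definition line_points (F : finFieldType) (L : line F) : {set point F} :=
  [set P : point F | (P <= L)%VS].

Definition unital (F : finFieldType) (q : nat) (U : {set point F}) : Prop :=
  #|U| = (q ^ 3 + 1)%N /\
  forall L : line F,
    #|U :&: line_points L| = 1%N \/ #|U :&: line_points L| = (q + 1)%N.

Definition zero_locus (F : finFieldType) (Q : {mpoly F[3]}) : {set point F} :=
  [set P : point F | [forall (v | v \in (P : {vspace _})), Q.@[v 0] == 0]].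

(* Geometric non-singularity: over no extension field is there a point of the
   curve at which all first-order partial derivatives vanish. This makes sense
   in every characteristic. *)
Definition nonsingular (F : fieldType) (Q : {mpoly F[3]}) : Prop :=
  forall (K : fieldType) (f : {rmorphism F -> K}) (v : 'rV[K]_3),
    (map_mpoly f Q).@[v 0] = 0 ->
    (forall i, ((map_mpoly f Q)^`M(i)).@[v 0] = 0) ->
    v = 0.

Definition irreducible_conic (F : finFieldType) (C : {set point F}) : Prop :=
  exists Q : {mpoly F[3]},
    [/\ Q != 0, Q \is 2.-homog, nonsingular Q & C = zero_locus Q].

Definition union_of_irreducible_conics (F : finFieldType)
    (U : {set point F}) : Prop :=
  exists S : {set {set point F}},
    (forall C, C \in S -> irreducible_conic C) /\ U = cover S.

(* 2yz - x^2 + az^2, with (x, y, z) = ('X_0, 'X_1, 'X_2). *)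
Definition conic_poly (F : finFieldType) (a : F) : {mpoly F[3]} :=
  2 *: ('X_1 * 'X_2) - 'X_0 ^+ 2 + a *: 'X_2 ^+ 2.

(* When #|F| = q ^ 2, the subfield GF(q) of F is the set of roots of
   X^q - X. *)
Definition GFq (F : finFieldType) (q : nat) : {set F} :=
  [set s : F | s ^+ q == s].

Definition behs (F : finFieldType) (q : nat) (t : F) : {set point F} :=
  \bigcup_(a in [set t * s | s in GFq F q]) zero_locus (conic_poly a).

Definition nonsquare (F : finFieldType) (t : F) : Prop :=
  ~ exists s : F, t = s ^+ 2.

Fact collineation_subproof (F : finFieldType) (g : {'GL_3[F]}) (P : point F) :
  \dim (linfun (mulmxr (val g)) @: P)%VS == 1%N.
Proof.
rewrite limg_dim_eq; first exact: (valP P).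
apply/eqP; rewrite -subv0; apply/subvP => v; rewrite memv_cap => /andP[_].
rewrite memv_ker lfunE /= => /eqP vg0.
by rewrite memv0 -(mulmxK (GL_unitmx g) v) vg0 mul0mx.
Qed.

(* The element of PGL(3, F) induced by g, acting on points. *)
Definition collineation (F : finFieldType) (g : {'GL_3[F]}) (P : point F) :
  point F := Point (collineation_subproof g P).

(* In odd characteristic, non-singularity means that the associated symmetric
   matrix has rank 3. *)
Lemma nonsingular_rank (F : fieldType) (A : 'M[F]_3) :
  2 != 0 :> F -> A^T = A ->
  nonsingular (\sum_i \sum_j A i j *: ('X_i * 'X_j)) <-> \rank A = 3.
Proof.
move=> two_neq0 symA; set Q := \sum_i _.
have mapQ (K : fieldType) (f : {rmorphism F -> K}) :
    map_mpoly f Q = \sum_i \sum_j f (A i j) *: ('X_i * 'X_j).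
  rewrite /Q rmorph_sum; apply: eq_bigr => i _ /=.
  rewrite rmorph_sum; apply: eq_bigr => j _ /=.
  by rewrite map_mpolyZ rmorphM /= !map_mpolyX.
have evalQ (K : fieldType) (f : {rmorphism F -> K}) (v : 'rV[K]_3) :
    (map_mpoly f Q).@[v 0] = (v *m map_mx f A *m v^T) 0 0.
  rewrite mapQ raddf_sum mxE /=.
  under [RHS]eq_bigr => j _ do rewrite !mxE big_distrl /=.
  rewrite [RHS]exchange_big /=; apply: eq_bigr => i _.
  rewrite raddf_sum; apply: eq_bigr => j _ /=.
  by rewrite mxE mevalZ mevalM !mevalXU mulrCA mulrA.
have derivX (K : fieldType) (v : 'rV[K]_3) (i k : 'I_3) :
    (('X_i : {mpoly K[3]})^`M(k)).@[v 0] = (i == k)%:R.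
  rewrite mderivX mevalZ mnm1E; case: eqP => [->|_]; last by rewrite mul0r.
  by rewrite mul1r -[X in (X - _)%MM]add0m addmK mpolyX0 meval1.
have derivQ (K : fieldType) (f : {rmorphism F -> K}) (v : 'rV[K]_3) k :
    ((map_mpoly f Q)^`M(k)).@[v 0] = 2 * (v *m map_mx f A) 0 k.
  rewrite mapQ (raddf_sum (mderiv k)) raddf_sum /= mxE.
  transitivity (\sum_i \sum_j
      (f (A i j) * ((i == k)%:R * v 0 j) + f (A i j) * (v 0 i * (j == k)%:R))).
    apply: eq_bigr => i _; rewrite (raddf_sum (mderiv k)) raddf_sum; apply: eq_bigr => j _ /=.
    by rewrite mderivZ mevalZ mderivM mevalD !mevalM !mevalXU !derivX mulrDr.
  under eq_bigr => i _ do rewrite big_split /=.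
  rewrite big_split /= mulrDl mul1r; congr (_ + _).
    rewrite exchange_big /=; apply: eq_bigr => j _.
    rewrite (bigD1 k) //= eqxx mul1r big1 ?addr0 => [|i /negPf->].
      by rewrite mxE -[in LHS]symA mxE mulrC.
    by rewrite mul0r mulr0.
  apply: eq_bigr => i _.
  rewrite (bigD1 k) //= eqxx mulr1 big1 ?addr0 => [|j /negPf->].
    by rewrite mxE mulrC.
  by rewrite !mulr0.
have two_neq0K (K : fieldType) (f : {rmorphism F -> K}) : 2 != 0 :> K.
  by rewrite -(rmorph_nat f) fmorph_eq0.
split=> [nsQ | rkA K f v _ dQ0].
  apply/eqP; rewrite -[_ == _]/(row_free A) -kermx_eq0; apply/eqP/row_matrixP=> i.
  rewrite row0; set v := row i _.
  have vA0 : v *m map_mx idfun A = 0.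
    by rewrite map_mx_id // /v -row_mul mulmx_ker row0.
  apply: (nsQ F idfun); first by rewrite evalQ vA0 mul0mx mxE.
  by move=> k; rewrite derivQ vA0 mxE mulr0.
have fA_free : row_free (map_mx f A) by rewrite /row_free mxrank_map rkA.
have vA0 : v *m map_mx f A = 0.
  apply/rowP => k; have /eqP := dQ0 k.
  by rewrite derivQ mulf_eq0 (negPf (two_neq0K K f)) [RHS]mxE => /eqP.
by apply: (row_free_inj fA_free); rewrite vA0 mul0mx.
Qed.

(* Main.v *)
Require Import Defs.
From mathcomp Require Import all_boot all_order all_fingroup all_algebra.
From mathcomp Require Import finfield cyclic mxabelem zify ring mpoly.
Set Implicit Arguments.
Unset Strict Implicit.
Unset Printing Implicit Defensive.
Import GRing.Theory.

(** Write F = GF(q^2), and let V be the set of nonzero vectors on points of U.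

    Counting on the lines through a point r of U shows that one of them meets U
    in r alone [tangent_exists]. If r lies on an irreducible conic C contained in
    U, this line is the tangent of C at r, because the other lines through r meet
    C twice [quadratic_inscribed]. So the tangents of C contain no further points
    of U. For q even the tangents of C concur in the nucleus of C and cover the
    plane, which leaves U = C, a set too small to be a unital [even_no_conic].

    Let q be odd. Then the points of U off C are internal to C: the quadratic form
    A of C takes nonsquare values there, up to its determinant [inscribed_nsq].
    Restricted to a parametrization of another conic C' in U, the form A becomes a
    binary quartic whose values are nonsquares or zero. Such a quartic is a
    constant times a square: if it has a zero then C and C' touch there, and a
    quadratic factor splits off; if it has none, the method of Stepanov applies
    [quartic_nonsquare_sqr]. Hence A = c A' + e l^2 for a linear form l, that is,
    any two conics in U span a pencil that contains a double line
    [inscribed_pencil].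

    If these double lines are not all equal, there are three conics whose three
    double lines are the sides of a triangle that is self-polar for all of them.
    Comparing square classes of the diagonal coefficients shows that U contains no
    fourth conic, and three conics have too few points [triangle_absurd]. So the
    double line is the same for all conics in U [common_pencil]. All conics meet it
    in the same points, at most two in number; so it meets U in one point, and is
    the tangent there. In suitable coordinates the conics are 2yz - x^2 + a z^2 = 0
    with a in a set S, which has q elements since the conics meet only in the point
    (0, 1, 0). By [inscribed_nsq] all differences of elements of S are nonsquares,
    and by a theorem of Blokhuis S = t GF(q) for a nonsquare t
    [blokhuis_nonsquare]. *)

(** * Nonsquares of a finite field of odd order *)

Section Nonsquares.
Local Open Scope ring_scope.
Variables (F : finFieldType) (n : nat).
Hypothesis cardF : #|F| = (2 * n).+1.

Lemma natr_card : #|F|%:R = 0 :> F.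
Proof. by rewrite -FinRing.zmodXgE -cardsT expg_cardG ?inE. Qed.

Lemma natr_double_half : (2 * n)%:R = -1 :> F.
Proof. by apply/eqP; rewrite -addr_eq0 addrC nat1r -cardF natr_card. Qed.

Lemma two_neq0 : 2 != 0 :> F.
Proof.
apply/eqP => two0; have := natr_double_half.
by rewrite natrM two0 mul0r => /eqP; rewrite eq_sym oppr_eq0 oner_eq0.
Qed.

Lemma half_card_gt0 : (0 < n)%N.
Proof. by have := finNzRing_gt1 F; rewrite cardF; lia. Qed.

Lemma expf_double_half x : x != 0 -> x ^+ (2 * n) = 1 :> F.
Proof. by move=> x0; apply: (mulfI x0); rewrite -exprS -cardF expf_card mulr1. Qed.

Lemma poly_eq0_values (f : {poly F}) :
  (size f <= #|F|)%N -> (forall x, f.[x] = 0) -> f = 0.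
Proof.
move=> szf f0; apply/eqP/contraT => nzf.
have /= := max_poly_roots nzf (rs := enum F).
rewrite enum_uniq -cardE ltnNge szf; apply => //.
by apply/allP => x _; rewrite rootE f0.
Qed.

(** Euler's criterion serves as the definition, since it makes the multiplicative
    properties computations with exponents. *)
Definition nsq (x : F) : bool := x ^+ n == -1.

Lemma nsq_neq0 x : nsq x -> x != 0.
Proof.
apply: contraL => /eqP->; rewrite /nsq expr0n eqn0Ngt half_card_gt0 /=.
by rewrite eq_sym oppr_eq0 oner_eq0.
Qed.

Lemma nsq_sqr x : nsq (x ^+ 2) = false.
Proof.
have [-> | x0] := eqVneq x 0.
  by apply/negP => /nsq_neq0; rewrite expr2 mul0r eqxx.
rewrite /nsq -exprM expf_double_half // -addr_eq0.
exact: negPf two_neq0.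
Qed.

Lemma nsq_sqrM x y : x != 0 -> nsq (x ^+ 2 * y) = nsq y.
Proof. by move=> x0; rewrite /nsq exprMn -exprM expf_double_half // mul1r. Qed.

Lemma expf_half x : x != 0 -> ~~ nsq x -> x ^+ n = 1.
Proof.
move=> x0; rewrite /nsq -addr_eq0 => nx.
have /eqP : (x ^+ n - 1) * (x ^+ n + 1) = 0.
  by rewrite -subr_sqr_1 -exprM mulnC expf_double_half // subrr.
by rewrite mulf_eq0 (negPf nx) orbF subr_eq0 => /eqP.
Qed.

Lemma nsqM x y : nsq x -> nsq y -> nsq (x * y) = false.
Proof.
rewrite /nsq exprMn => /eqP-> /eqP->; rewrite mulrNN mulr1 -addr_eq0.
exact: negPf two_neq0.
Qed.

Lemma finField_prim_root : exists g : F, (2 * n).-primitive_root g.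
Proof.
have n0 := half_card_gt0.
have n2 : (0 < 2 * n)%N by lia.
pose rs := enum [pred y : F | y != 0].
suff /hasP[g _ ?] : has (2 * n).-primitive_root rs by exists g.
apply: has_prim_root => //.
- apply/allP => y; rewrite mem_enum inE => y0.
  by apply/unity_rootP; apply: expf_double_half.
- exact: enum_uniq.
- by rewrite -cardE (cardC1 (0 : F)) cardF.
Qed.

Lemma not_nsq_sqr x : ~~ nsq x -> exists s, x = s ^+ 2.
Proof.
have [-> _ | x0 nx] := eqVneq x 0; first by exists 0; rewrite expr2 mul0r.
have xn := expf_half x0 nx.
have n0 := half_card_gt0.
have [g primg] := finField_prim_root.
have [i xi] := prim_rootP primg (expf_double_half x0).
have : g ^+ (i * n) == 1 by rewrite exprM -xi xn.
rewrite -(prim_order_dvd primg) dvdn_pmul2r //.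
by move=> /dvdnP[k ik]; exists (g ^+ k); rewrite xi ik exprM.
Qed.

End Nonsquares.

(** * Polynomials without square values *)

Section NonsquareValues.
Local Open Scope ring_scope.

Lemma coefM_top (R : nzRingType) (f g : {poly R}) i j :
  (size f <= i.+1)%N -> (size g <= j.+1)%N -> (f * g)`_(i + j) = f`_i * g`_j.
Proof.
move=> szf szg; rewrite coefM.
have lti : (i < (i + j).+1)%N by lia.
rewrite (bigD1 (Ordinal lti)) //= addKn big1 ?addr0 // => k /eqP ki.
have [lt_ik | le_ki] := ltnP i k.
  by rewrite nth_default ?mul0r // (leq_trans szf).
have ltki : (k < i)%N.
  by rewrite ltn_neqAle le_ki andbT; apply/eqP => e; apply: ki; apply: val_inj.
by rewrite [X in _ * X]nth_default ?mulr0 // (leq_trans szg) //; lia.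
Qed.

Variables (F : finFieldType) (n : nat).
Hypothesis cardF : #|F| = (2 * n).+1.

(** The polynomial f^n + 1 vanishes on F and has degree less than #|F|, so it is
    zero. *)
Lemma quadratic_nonsquare_const (f : {poly F}) :
  (size f <= 3)%N -> (forall x, nsq n f.[x]) -> exists c, f = c%:P.
Proof.
move=> szf nsqf.
have szfn : (size (f ^+ n) <= #|F|)%N.
  apply: leq_trans (size_poly_exp_leq _ _) _; rewrite cardF ltnS.
  by rewrite leq_mul2r; case: (size f) szf => //= m; lia.
have fn : f ^+ n = (-1)%:P.
  apply/eqP; rewrite -subr_eq0; apply/eqP/poly_eq0_values.
    apply: leq_trans (size_polyD _ _) _; rewrite geq_max szfn size_polyN.
    by apply: leq_trans (size_polyC_leq1 _) _; rewrite cardF.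
  by move=> x; rewrite !hornerE (eqP (nsqf x)) subrr.
have : size (f ^+ n) = 1%N.
  by rewrite fn size_polyC oppr_eq0 oner_eq0.
have f0 : f != 0.
  apply/eqP => e; have := nsq_neq0 cardF (nsqf 0).
  by rewrite e horner0 eqxx.
have szf0 : (0 < size f)%N by rewrite size_poly_gt0.
have n0 := half_card_gt0 cardF.
move=> szfn1; have := size_exp f n.
rewrite szfn1 => /esym/eqP; rewrite muln_eq0 orbC gtn_eqF //= => /eqP szf1.
by exists f`_0; apply: size1_polyC; move: szf1; case: (size f) => [|[]].
Qed.

(** The method of Stepanov for the curve y^2 = f(x). Let W = X^#|F| - X, so that
    f^n + 1 = h W. Differentiating, and using 2 n = -1 and W' = -1 in F, one finds
    W k = 2 f h + f' for k = 2 f h' + f' h, which has degree at most 2.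
    Differentiating again, W divides a polynomial of degree at most 6; as
    #|F| > 6, this polynomial is zero, and f' k = 2 f k'. So k^2 / f has
    derivative 0, and r = f - c k^2 satisfies r' f = r f' for every constant c. For
    the c that cancels the leading coefficient, comparing degrees gives r = 0. *)
Lemma quartic_nonsquare_sqr (f : {poly F}) :
  (4 <= n)%N -> size f = 5%N -> (forall x, nsq n f.[x]) ->
  exists (c : F) (k : {poly F}), (size k <= 3)%N /\ f = c *: k ^+ 2.
Proof.
move=> n4 szf nsqf.
have f0 : f != 0 by rewrite -size_poly_gt0 szf.
have two0 : 2 != 0 :> F := two_neq0 cardF.
pose W : {poly F} := 'X^(#|F|) - 'X.
have szW : size W = #|F|.+1.
  by rewrite size_polyDl size_polyXn // size_polyN size_polyX cardF; lia.
have W0 : W != 0 by rewrite -size_poly_gt0 szW.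
have dW : W^`() = -1.
  by rewrite derivB derivXn derivX -mulr_natr -polyC_natr natr_card mulr0 sub0r.
have [h fnE] : exists h : {poly F}, f ^+ n + 1 = h * W.
  apply/dvdpP; rewrite /W finField_genPoly -big_enum.
  rewrite uniq_roots_dvdp //; last by rewrite uniq_rootsE enum_uniq.
  apply/allP => x _; rewrite rootE !hornerE (eqP (nsqf x)).
  by rewrite addNr.
have dfn : 2 * f * (f ^+ n)^`() = - (f^`() * f ^+ n).
  have n2 : (2 * n)%:R = -1 :> {poly F}.
    by rewrite -polyC_natr natr_double_half // polyCN.
  rewrite deriv_exp -mulr_natl -mulN1r -n2 natrM.
  have -> : f ^+ n = f * f ^+ n.-1 by rewrite -exprS (ltn_predK (half_card_gt0 cardF)).
  ring.
have dhW : (f ^+ n)^`() = h^`() * W - h.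
  by rewrite -[f ^+ n](addrK 1) fnE derivB derivM dW -[1]/(1%:P) derivC; ring.
pose k : {poly F} := 2 * f * h^`() + f^`() * h.
have WkE : W * k = 2 * f * h + f^`().
  have : 2 * f * (h^`() * W - h) = - (f^`() * (h * W - 1)).
    by rewrite -dhW dfn -fnE addrK.
  move/eqP; rewrite -subr_eq0 => /eqP e; apply/eqP.
  by rewrite -subr_eq0 -e /k; apply/eqP; ring.
have dWkE : f^`() * h = W * k^`() - 2 * k - (f^`())^`().
  have : (W * k)^`() = (2 * f * h + f^`())^`() by rewrite WkE.
  have d2 : 2^`() = 0 :> {poly F} by rewrite -polyC_natr derivC.
  rewrite derivD !derivM dW d2.
  move/eqP; rewrite -subr_eq0 => /eqP e; apply/eqP.
  by rewrite -subr_eq0 -oppr_eq0 -e /k; apply/eqP; ring.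
have key : W * (f^`() * k - 2 * f * k^`()) = f^`() ^+ 2 - 4 * f * k - 2 * f * (f^`())^`().
  have e : f^`() * (W * k - f^`()) = 2 * f * (W * k^`() - 2 * k - (f^`())^`()).
    by rewrite -dWkE WkE; ring.
  move/eqP: e; rewrite -subr_eq0 => /eqP e; apply/eqP.
  by rewrite -subr_eq0 -e; apply/eqP; ring.
have n0 := half_card_gt0 cardF.
have szfn : size (f ^+ n) = (4 * n).+1.
  by rewrite (polySpred (expf_neq0 n f0)) size_exp szf.
have szh : size h = (2 * n)%N.
  have szf1 : size (f ^+ n + 1) = (4 * n).+1.
    by rewrite size_polyDl szfn // size_poly1; lia.
  have h0 : h != 0.
    by apply/eqP => h0; move: szf1; rewrite fnE h0 mul0r size_poly0.
  by move: szf1; rewrite fnE size_mul // szW cardF; move: (size h) => s; lia.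
have h0 : h != 0 by rewrite -size_poly_gt0 szh; lia.
have size_smul (a : nat) (g : {poly F}) : (size (a%:R * g)%R <= size g)%N.
  by rewrite mulr_natl -scaler_nat size_scale_leq.
have szf' : (size f^`() <= 4)%N by rewrite -ltnS -szf lt_size_deriv.
have szf'' : (size (f^`())^`() <= 4)%N.
  apply: leq_trans szf'; have [-> | nz] := eqVneq f^`() 0; first by rewrite derivC size_poly0.
  exact/ltnW/lt_size_deriv.
have szk : (size k <= 3)%N.
  have [-> | nzk] := eqVneq k 0; first by rewrite size_poly0.
  have : (size (W * k)%R <= 2 * n + 4)%N.
    rewrite WkE; apply: leq_trans (size_polyD _ _) _.
    rewrite geq_max; apply/andP; split; last by lia.
    by rewrite -mulrA; apply: leq_trans (size_smul _ _) _; rewrite size_mul // szf szh; lia.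
  by rewrite size_mul // szW cardF; move: (size k) => s; lia.
have eq1 : f^`() * k = 2 * f * k^`().
  apply/eqP; rewrite -subr_eq0; apply/contraT => nz.
  have : (size (W * (f^`() * k - 2 * f * k^`()))%R <= 8)%N.
    rewrite key; apply: leq_trans (size_polyD _ _) _; rewrite geq_max size_polyN.
    rewrite -!mulrA; apply/andP; split; last first.
      apply: leq_trans (size_smul _ _) _; apply: leq_trans (size_polyMleq _ _) _.
      by rewrite szf; move: (size _) szf'' => s; lia.
    apply: leq_trans (size_polyD _ _) _; rewrite geq_max size_polyN.
    apply/andP; split;
      first by apply: leq_trans (size_polyMleq _ _) _; move: (size _) szf' => s; lia.
    apply: leq_trans (size_smul _ _) _; apply: leq_trans (size_polyMleq _ _) _.
    by rewrite szf; move: (size _) szk => s; lia.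
  by move: nz; rewrite -size_poly_gt0 => nz;
    rewrite size_mul -?size_poly_gt0 // szW cardF; move: (size _) nz => s; lia.
have f4 : f`_4 != 0.
  by have := lead_coef_eq0 f; rewrite lead_coefE szf => ->.
have f'3 : f^`()`_3 = f`_4 * 4 by rewrite coef_deriv mulr_natr.
have four0 : 4 != 0 :> F by rewrite (natrM F 2 2) mulf_neq0.
have k0 : k != 0.
  apply/eqP => k0; have /(congr1 (fun g : {poly F} => size g)) := WkE.
  rewrite k0 mulr0 size_poly0 -mulrA mulr_natl -scaler_nat size_polyDl.
    by rewrite size_scale // size_mul // szf szh; lia.
  by rewrite size_scale // size_mul // szf szh; lia.
have sz2f : (size (2 * f)%R <= 5)%N by rewrite -szf.
have c2f : (2 * f)`_4 = 2 * f`_4 by rewrite mulr_natl coefMn mulr_natl.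
have szk' m : (size k <= m.+1)%N -> (size k^`() <= m)%N.
  by move=> szkm; rewrite -ltnS; apply: leq_trans szkm; apply: lt_size_deriv.
have k2 : k`_2 != 0.
  apply/eqP => k2; have szk2 : (size k <= 2)%N.
    by apply/leq_sizeP => -[|[|[|j]]] // _; rewrite nth_default // (leq_trans szk).
  have k1 : k`_1 = 0.
    have := congr1 (fun g : {poly F} => g`_(3 + 1)) eq1.
    rewrite /= coefM_top // [RHS](@coefM_top _ _ _ 4 0) ?szk' // f'3 c2f coef_deriv.
    move/eqP; rewrite -subr_eq0 -[X in X == 0]/_.
    have -> : f`_4 * 4 * k`_1 - 2 * f`_4 * (k`_1 *+ 1) = 2 * f`_4 * k`_1 by ring.
    by rewrite !mulf_eq0 (negPf two0) (negPf f4) => /eqP.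
  have szk1 : (size k <= 1)%N.
    by apply/leq_sizeP => -[|[|j]] // _; rewrite nth_default // (leq_trans szk2).
  have := congr1 (fun g : {poly F} => g`_(3 + 0)) eq1.
  rewrite /= coefM_top // f'3.
  have -> : k^`() = 0 by apply/eqP; rewrite -size_poly_leq0; apply: szk'.
  rewrite mulr0 coef0 => /eqP; rewrite !mulf_eq0 (negPf four0) (negPf f4) /= => /eqP k00.
  by move: k0; rewrite (size1_polyC szk1) k00 eqxx.
pose c := f`_4 / k`_2 ^+ 2.
pose r := f - c *: k ^+ 2.
have eq2 : r^`() * f = r * f^`().
  rewrite /r derivB derivZ expr2 derivM -!mul_polyC.
  apply/eqP; rewrite -subr_eq0.
  rewrite (_ : _ - _ = c%:P * k * (f^`() * k - 2 * f * k^`())); last by ring.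
  by rewrite eq1 subrr mulr0.
exists c, k; split => //; apply/eqP; rewrite -subr_eq0 -/r; apply/contraT => r0.
have szr : (size r <= 4)%N.
  apply/leq_sizeP => j; rewrite leq_eqVlt => /orP[/eqP<- | j4].
    rewrite coefB coefZ expr2 (@coefM_top _ k k 2 2) // /c; field.
    by rewrite k2.
  rewrite nth_default // (leq_trans (size_polyD _ _)) // geq_max szf j4.
  rewrite size_polyN (leq_trans (size_scale_leq _ _)) // (leq_trans (size_poly_exp_leq _ _)) //.
  by move: (size k) szk => s; lia.
have rd : forall d, size r = d.+1 -> (4 - d%:R : F) = 0.
  move=> d szrd.
  have rd0 : r`_d != 0 by have := lead_coef_eq0 r; rewrite lead_coefE szrd => ->.
  have := congr1 (fun g : {poly F} => g`_(d + 3)) eq2.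
  rewrite /= [RHS]coefM_top ?szrd // f'3.
  have -> : (r^`() * f)`_(d + 3) = d%:R * r`_d * f`_4.
    case: d szrd {rd0} => [|d] szrd.
      by rewrite (size1_polyC (eq_leq szrd)) derivC mul0r coef0 !mul0r.
    rewrite addSnnS coefM_top ?szf //; last by rewrite -ltnS -szrd lt_size_deriv.
    by rewrite coef_deriv mulr_natl.
  move/eqP; rewrite -subr_eq0 -oppr_eq0.
  rewrite (_ : - _ = (4 - d%:R) * (r`_d * f`_4)); last by ring.
  by rewrite mulf_eq0 mulf_eq0 (negPf rd0) (negPf f4) !orbF => /eqP.
(* The degree of r is 4 in F, so it is 1 and the characteristic is 3; the
   root of r in F is then a root of f. *)
have szr2 : size r = 2%N.
  have : (0 < size r)%N by rewrite size_poly_gt0.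
  case: (size r) szr rd => [|[|[|[|[|]]]]] // _ rd _.
  - by have /eqP := rd _ erefl; rewrite subr0 (negPf four0).
  - have /eqP := rd _ erefl; rewrite (_ : 4 - 2%:R = 2); last by ring.
    by rewrite (negPf two0).
  - have /eqP := rd _ erefl; rewrite (_ : 4 - 3%:R = 1); last by ring.
    by rewrite oner_eq0.
have r1 : r`_1 != 0 by have := lead_coef_eq0 r; rewrite lead_coefE szr2 => ->.
clearbody r.
have rE : r = r`_1 *: 'X + (r`_0)%:P.
  apply/polyP => -[|[|j]]; rewrite !coefE /= ?mulr0 ?add0r ?mulr1 ?addr0 //.
  by apply: nth_default; rewrite szr2.
pose s := - r`_0 / r`_1.
have rs : r.[s] = 0 by rewrite {1}rE 2!hornerE hornerX hornerC mulrC divfK // addNr.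
have r's : r^`().[s] = r`_1.
  by rewrite {1}rE derivD derivZ derivX derivC addr0 hornerZ hornerC mulr1.
have := congr1 (fun g : {poly F} => g.[s]) eq2.
rewrite /= !hornerM rs r's mul0r => /eqP.
by rewrite mulf_eq0 (negPf r1) (negPf (nsq_neq0 cardF (nsqf _))).
Qed.

End NonsquareValues.

(** * Blokhuis's theorem on sets with nonsquare differences *)

Section NonsquareDifferences.
Local Open Scope ring_scope.

Lemma size_coef_prod_XsubC (R : comNzRingType) (s : seq {poly R}) i j :
  (forall c, c \in s -> (size c <= 2)%N) -> (i + j = size s)%N ->
  (size ((\prod_(c <- s) ('X - c%:P))`_i)%R <= j.+1)%N.
Proof.
elim: s i j => [|c s IHs] i j szs /= ij.
  by rewrite big_nil coef1; case: eqP => _; rewrite ?size_poly1 ?size_poly0.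
have szs' d : d \in s -> (size d <= 2)%N by move=> ds; rewrite szs // inE ds orbT.
rewrite big_cons mulrBl coefB coefXM mul_polyC coefZ.
set P := \prod_(_ <- _) _ in IHs *.
have szP : size P = (size s).+1 by rewrite size_prod_XsubC.
apply: leq_trans (size_polyD _ _) _; rewrite geq_max size_polyN; apply/andP; split.
  case: i ij => [|i] /= ij; first by rewrite size_poly0.
  by apply: IHs => //; lia.
case: j ij => [|j] ij.
  by rewrite nth_default ?mulr0 ?size_poly0 // szP; lia.
apply: leq_trans (size_polyMleq _ _) _.
have : (size (P`_i)%R <= j.+1)%N by apply: IHs => //; lia.
have : (size c <= 2)%N by rewrite szs // inE eqxx.
by move: (size _) (size _) => u v; lia.
Qed.

Variables (F : finFieldType) (n q m : nat).
Hypothesis cardF : #|F| = (2 * n).+1.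
Hypotheses (cardFq : #|F| = (q ^ 2)%N) (qE : q = (2 * m).+1) (m_gt0 : (0 < m)%N).
Hypothesis frobD : forall x y : F, (x + y) ^+ q = x ^+ q + y ^+ q.

Lemma half_card_factor : n = (2 * m * m.+1)%N.
Proof. by have := cardFq; rewrite cardF qE; lia. Qed.

Definition nsq_differences (A : {set F}) :=
  forall a b, a \in A -> b \in A -> a != b -> nsq n (a - b).

(** Let H be the product of the X - (a + a^q z) over a in A, with z a second
    variable. If (-z)^(m+1) = 1 then a + a^q z takes q distinct values on A, all of
    them roots of X^q - z^q X, so H specializes to this polynomial. The coefficient
    of X^(q-j) in H has degree at most j in z and m+1 roots, so it is zero when
    0 < j <= m. Take z = 0. *)
Lemma coef_nsq_differences (A : {set F}) j :
  #|A| = q -> nsq_differences A -> (0 < j <= m)%N ->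
  (\prod_(a in A) ('X - a%:P))`_(q - j) = 0.
Proof.
move=> cardA nsqA jm.
pose lin (a : F) : {poly F} := a%:P + a ^+ q *: 'X.
pose H : {poly {poly F}} := \prod_(c <- [seq lin a | a <- enum A]) ('X - c%:P).
have HE z : map_poly (horner_eval z) H = \prod_(a in A) ('X - (a + a ^+ q * z)%:P).
  rewrite /H big_map rmorph_prod -big_enum /=; apply: eq_bigr => a _.
  by rewrite rmorphB /= map_polyX map_polyC /= /horner_eval /lin !hornerE.
have cH z i : (H`_i).[z] = (\prod_(a in A) ('X - (a + a ^+ q * z)%:P))`_i.
  by rewrite -HE coef_map.
suff H0 : H`_(q - j) = 0.
  rewrite -[RHS](horner0 0) -H0 cH; congr ((_ : {poly F})`__).
  by apply: eq_bigr => a _; rewrite mulr0 addr0.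
have szH : (size (H`_(q - j)%N)%R <= j.+1)%N.
  apply: size_coef_prod_XsubC.
    move=> c /mapP[a _ ->]; apply: leq_trans (size_polyD _ _) _; rewrite geq_max.
    rewrite (leq_trans (size_polyC_leq1 _)) //=.
    by rewrite (leq_trans (size_scale_leq _ _)) ?size_polyX.
  by rewrite size_map -cardE cardA; lia.
have [g primg] := finField_prim_root cardF.
have [z primz] : exists z : F, m.+1.-primitive_root z.
  exists (g ^+ ((2 * n) %/ m.+1)); apply: (dvdn_prim_root primg).
  by rewrite half_card_factor mulnA dvdn_mull.
apply/eqP/contraT => nzH.
pose rs := [seq - z ^+ i | i <- iota 0 m.+1].
suff /(max_poly_roots nzH) roots_lt : all (root H`_(q - j)) rs.
  suff /roots_lt : uniq rs.
    by rewrite size_map size_iota ltnNge (leq_trans szH); last by lia.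
  rewrite map_inj_in_uniq ?iota_uniq // => a b.
  rewrite !mem_iota /= add0n => am bm /oppr_inj /eqP.
  by rewrite (eq_prim_root_expr primz) /= !modn_small // => /eqP.
  apply/allP => y /mapP[i _ ->]; set w := - z ^+ i.
  rewrite rootE cH.
  have wm : (- w) ^+ m.+1 = 1 by rewrite opprK exprAC (prim_expr_order primz) expr1n.
  have wq : w ^+ q.+1 = 1.
    have -> : q.+1 = (2 * m.+1)%N by lia.
    by rewrite exprM -sqrrN -exprM mulnC exprM wm expr1n.
  have -> : \prod_(a in A) ('X - (a + a ^+ q * w)%:P) = 'X^q - w ^+ q *: 'X.
    have szX : size ('X^q - w ^+ q *: 'X : {poly F}) = q.+1.
      rewrite size_polyDl size_polyXn // size_polyN.
      by rewrite (leq_ltn_trans (size_scale_leq _ _)) // size_polyX; lia.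
    have monX : 'X^q - w ^+ q *: 'X \is monic.
      rewrite monicE lead_coefE szX /= coefB coefXn eqxx coefZ coefX.
      by rewrite (_ : q == 1%N = false) ?mulr0 ?subr0 //; lia.
    rewrite -big_enum -(big_map (fun a => a + a ^+ q * w) predT (fun c => 'X - c%:P)).
    rewrite [RHS](@all_roots_prod_XsubC _ _ [seq a + a ^+ q * w | a <- enum A]).
    - by rewrite (monicP monX) scale1r.
    - by rewrite szX size_map -cardE cardA.
    - apply/allP => x /mapP[a _ ->]; rewrite rootE !hornerE.
      rewrite frobD exprMn -exprM mulnn -cardFq expf_card.
      rewrite (_ : _ - _ = a ^+ q * (1 - w * w ^+ q)); last by ring.
      by rewrite -exprS wq subrr mulr0.
    - rewrite uniq_rootsE map_inj_in_uniq ?enum_uniq // => a b.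
      rewrite !mem_enum => aA bA ab; apply/eqP/contraT => neq_ab.
      pose d := a - b; have nsqd : nsq n d by apply: nsqA.
      have dw : d ^+ (2 * m) * - w = 1.
        apply: (mulfI (nsq_neq0 cardF nsqd)).
        rewrite mulrA -exprS -qE mulr1 mulrN; apply/eqP; rewrite eq_sym -addr_eq0.
        have aq : a ^+ q = d ^+ q + b ^+ q by rewrite -frobD subrK.
        move/eqP: ab; rewrite -subr_eq0 aq /d => /eqP ab; apply/eqP.
        by rewrite -ab; ring.
      have := congr1 (fun x => x ^+ m.+1) dw.
      rewrite /= exprMn wm mulr1 -exprM -half_card_factor expr1n (eqP nsqd).
      move=> /esym/eqP; rewrite -addr_eq0.
      by rewrite (negPf (two_neq0 cardF)).
  rewrite coefB coefXn coefZ coefX.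
  have -> : (q - j == q)%N = false by apply/eqP; clear -qE jm; lia.
  have -> : (q - j == 1)%N = false by apply/eqP; clear -qE jm; lia.
  by rewrite mulr0 subrr.
Qed.

(** 1/a - 1/b = (b - a)/(a b), where a b is a square, being the product of the
    nonsquares a - 0 and b - 0. *)
Lemma nsq_differences_inv (A : {set F}) :
  0 \in A -> nsq_differences A -> nsq_differences [set a^-1 | a in A].
Proof.
move=> A0 nsqA _ _ /imsetP[a aA ->] /imsetP[b bA ->] neq_ab.
have nsq0 c : c \in A -> c != 0 -> nsq n c.
  by move=> cA c0; rewrite -[c]subr0 nsqA.
have nab : a != b by apply: contra_neq neq_ab => ->.
have [a0 | a0] := eqVneq a 0.
  have b0 : b != 0 by rewrite -a0 eq_sym.
  rewrite a0 invr0 sub0r (_ : - b^-1 = b^-1 ^+ 2 * (a - b)) ?nsq_sqrM ?invr_neq0 ?nsqA //.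
  by rewrite a0; field.
have [b0 | b0] := eqVneq b 0.
  rewrite b0 invr0 subr0 (_ : a^-1 = a^-1 ^+ 2 * a) ?nsq_sqrM ?invr_neq0 ?nsq0 //.
  by field.
have [s ab] : exists s, a * b = s ^+ 2.
  by apply: (not_nsq_sqr cardF); rewrite (nsqM cardF) ?nsq0.
have s0 : s != 0.
  by apply/eqP => s0; move/eqP: ab; rewrite s0 expr2 mul0r mulf_eq0 (negPf a0) (negPf b0).
rewrite (_ : _ - _ = s^-1 ^+ 2 * (b - a)); last by rewrite exprVn -ab; field; rewrite a0 b0.
by rewrite nsq_sqrM ?invr_neq0 // nsqA // eq_sym.
Qed.

(** The polynomial of the inverses is the reversed polynomial of A, up to a
    factor; the fixed point 0 of inversion shifts the coefficients by one. *)
Lemma prod_XsubC_inv (A : {set F}) : 0 \in A -> #|A| = q ->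
  exists C, \prod_(a in [set a^-1 | a in A]) ('X - a%:P) =
    C *: \poly_(k < q.+1) (\prod_(a in A) ('X - a%:P))`_(q.+1 - k).
Proof.
move=> A0 cardA; set f := \prod_(a in A) _.
have szf : size f = q.+1 by rewrite /f -big_enum size_prod_XsubC -cardE cardA.
have f0 : f`_0 = 0.
  by rewrite -horner_coef0 /f (bigD1 0) //= hornerM hornerXsubC subrr mul0r.
pose C := \prod_(a in A | a != 0) - a^-1.
exists C; rewrite big_imset /=; last by move=> a b _ _ /invr_inj.
apply/eqP; rewrite -subr_eq0; apply/eqP/(poly_eq0_values).
  apply: leq_trans (size_polyD _ _) _; rewrite geq_max size_polyN.
  rewrite -big_enum -(big_map (fun a => a^-1) predT (fun c => 'X - c%:P)) size_prod_XsubC.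
  rewrite size_map -cardE cardA (leq_trans (size_scale_leq _ _)) ?(leq_trans (size_poly _ _)) //.
    by rewrite cardFq; lia.
  by rewrite cardFq; lia.
move=> x; rewrite hornerD hornerN hornerZ horner_poly horner_prod.
rewrite (bigD1 0) //= !hornerE invr0 subr0 big_ord_recl.
rewrite subn0 nth_default ?szf // mul0r add0r.
have [-> | x0] := eqVneq x 0.
  rewrite mul0r big1 ?mulr0 ?subrr // => i _.
  by rewrite /= exprS mul0r mulr0.
have prodE : \prod_(a in A | a != 0) ('X - (a^-1)%:P).[x] =
    C * x ^+ q.-1 * \prod_(a in A | a != 0) (x^-1 - a).
  rewrite /C -cardA (cardsD1 0 A) A0 /= -prodr_const.
  rewrite (eq_bigl (fun a => (a \in A) && (a != 0)) (fun _ => x)); last first.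
    by move=> a; rewrite !inE andbC.
  rewrite -!big_split /=; apply: eq_bigr => a /andP[_ a0].
  by rewrite !hornerE; field; rewrite a0 x0.
have fxV : f.[x^-1] = x^-1 * \prod_(a in A | a != 0) (x^-1 - a).
  rewrite /f horner_prod (bigD1 0) //= !hornerE subr0; congr (_ * _).
  by apply: eq_bigr => a _; rewrite !hornerE.
have -> : \sum_(i < q) f`_(q.+1 - bump 0 i) * x ^+ bump 0 i = x ^+ q.+1 * f.[x^-1].
  rewrite horner_coef szf big_ord_recl f0 mul0r add0r big_distrr /=.
  rewrite (reindex_inj rev_ord_inj) /=; apply: eq_bigr => i _.
  rewrite /bump /= !add1n subSS.
  have lt_iq := ltn_ord i.
  have -> : (q - (q - i.+1) = i.+1)%N by clear -lt_iq; lia.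
  have -> : q.+1 = ((q - i.+1).+1 + i.+1)%N by clear -lt_iq; lia.
  by rewrite exprD mulrCA -[in RHS]mulrA -exprMn divff // expr1n mulr1.
rewrite prodE fxV qE /= exprS exprS; field.
by rewrite x0.
Qed.

(** Let f be the polynomial of A. The coefficients of f between X^m and X^q vanish
    by [coef_nsq_differences], and those from X^2 up to X^(m+1) vanish because the
    same lemma applies to the inverses of the elements of A. What remains is
    f = X^q + f_1 X, whose roots form a line over GF(q). *)
Theorem blokhuis_nonsquare (A : {set F}) :
  0 \in A -> #|A| = q -> nsq_differences A ->
  exists2 t, nsq n t & A = [set t * s | s in GFq F q].
Proof.
move=> A0 cardA nsqA; set f := \prod_(a in A) ('X - a%:P).
have szf : size f = q.+1 by rewrite /f -big_enum size_prod_XsubC -cardE cardA.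
have fhigh j : (0 < j <= m)%N -> f`_(q - j) = 0 by apply: coef_nsq_differences.
have flow j : (0 < j <= m)%N -> f`_j.+1 = 0.
  move=> jm; have [C fV] := prod_XsubC_inv A0 cardA.
  have cardV : #|[set a^-1 | a in A]| = q by rewrite card_imset //; apply: invr_inj.
  have := coef_nsq_differences cardV (nsq_differences_inv A0 nsqA) jm.
  rewrite fV coefZ coef_poly ifT; last by lia.
  rewrite (_ : q.+1 - (q - j) = j.+1)%N; last by lia.
  move/eqP; rewrite mulf_eq0 => /orP[/eqP C0 | /eqP //].
  have : size (\prod_(a in [set a^-1 | a in A]) ('X - a%:P)) = q.+1.
    by rewrite -big_enum size_prod_XsubC -cardE cardV.
  by rewrite fV C0 scale0r size_poly0.
have fE : f = 'X^q + f`_1 *: 'X.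
  apply/polyP => i; rewrite coefD coefXn coefZ coefX.
  have [-> | ] := eqVneq i q.
    have /monicP : f \is monic by rewrite /f -big_enum monic_prod_XsubC.
    rewrite lead_coefE szf /= => ->.
    by rewrite (_ : q == 1 = false)%N ?mulr0 ?addr0 //; lia.
  rewrite add0r => neq_iq; case: i neq_iq => [|[|i]] neq_iq.
  - by rewrite mulr0 -horner_coef0 /f (bigD1 0) //= hornerM hornerXsubC subrr mul0r.
  - by rewrite mulr1.
  rewrite mulr0; have [lt_qi | le_iq] := ltnP q i.+2; first by rewrite nth_default // szf.
  have [le_im | lt_mi] := leqP i.+1 m; first by apply: flow.
  have -> : i.+2 = (q - (q - i.+2))%N by lia.
  by apply: fhigh; lia.
have Aroot a : (a \in A) = (a ^+ q == - f`_1 * a).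
  have -> : (a \in A) = root f a.
    by rewrite /f -big_enum root_prod_XsubC mem_enum.
  by rewrite rootE {1}fE !hornerE mulNr addr_eq0.
have [t tA t0] : exists2 t, t \in A & t != 0.
  have : (0 < #|A :\ 0%R|)%N
    by move: (cardsD1 0 A); rewrite A0 cardA qE add1n => -[<-]; rewrite muln_gt0.
  by move=> /card_gt0P[t]; rewrite !inE => /andP[]; exists t.
exists t; first by rewrite -[t]subr0 nsqA.
have tq : t ^+ q = - f`_1 * t by apply/eqP; rewrite -Aroot.
have f1 : - f`_1 != 0.
  by apply: contra_neq (expf_neq0 q t0) => e; rewrite tq e mul0r.
apply/setP => a; apply/idP/imsetP => [aA | [s]]; last first.
  by rewrite inE => /eqP sq ->; rewrite Aroot exprMn sq tq mulrA.
exists (a / t); last by rewrite mulrCA divff ?mulr1.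
have aq : a ^+ q = - f`_1 * a by apply/eqP; rewrite -Aroot.
rewrite inE exprMn exprVn tq aq; move: (- f`_1) f1 => c c0.
by apply/eqP; field; rewrite t0 c0.
Qed.

End NonsquareDifferences.

(** * Bilinear and quadratic forms on F^3 *)

Section Forms.
Local Open Scope ring_scope.

Lemma ord3_ind (P : 'I_3 -> Prop) : P 0 -> P 1 -> P 2 -> forall i, P i.
Proof.
by move=> P0 P1 P2 [[|[|[|]]] //= i3]; [move: P0 | move: P1 | move: P2];
   congr P; apply: val_inj.
Qed.

Variable F : fieldType.
Implicit Types (A M N : 'M[F]_3) (u v w r : 'rV[F]_3) (a b c d e : F).

Lemma sum_ord3 (f : 'I_3 -> F) : \sum_i f i = f 0 + f 1 + f 2.
Proof.
rewrite !big_ord_recl big_ord0 addr0 addrA.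
by congr (_ + f _ + f _); apply: val_inj.
Qed.

Lemma row3P u v : u 0 0 = v 0 0 -> u 0 1 = v 0 1 -> u 0 2 = v 0 2 -> u = v.
Proof. by move=> e0 e1 e2; apply/rowP; apply: ord3_ind. Qed.

Definition row3 (a b c : F) : 'rV[F]_3 := \row_i [:: a; b; c]`_i.

Lemma row3E a b c :
  (row3 a b c 0 0 = a) * (row3 a b c 0 1 = b) * (row3 a b c 0 2 = c).
Proof. by rewrite !mxE. Qed.

Lemma row3_neq0 (a b c : F) : [|| a != 0, b != 0 | c != 0] -> row3 a b c != 0.
Proof.
apply: contraTneq => /rowP e; have := e 0; have := e 1; have := e 2.
by rewrite !row3E !mxE => -> -> ->; rewrite eqxx.
Qed.

Definition mx3 u v w : 'M[F]_3 := \matrix_i [:: u; v; w]`_i.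

Lemma row_mx3 u v w :
  (row 0 (mx3 u v w) = u) * (row 1 (mx3 u v w) = v) * (row 2 (mx3 u v w) = w).
Proof. by rewrite !rowK. Qed.

Lemma mul_rV3 u M : u *m M = u 0 0 *: row 0 M + u 0 1 *: row 1 M + u 0 2 *: row 2 M.
Proof.
rewrite mulmx_sum_row !big_ord_recl big_ord0 addr0 addrA.
by congr (u 0 _ *: row _ M + u 0 _ *: row _ M + u 0 _ *: row _ M); apply: val_inj.
Qed.

Definition bil A u v : F := (u *m A *m v^T) 0 0.

Lemma bilE A u v :
  bil A u v = u 0 0 * (A 0 0 * v 0 0 + A 0 1 * v 0 1 + A 0 2 * v 0 2)
             + u 0 1 * (A 1 0 * v 0 0 + A 1 1 * v 0 1 + A 1 2 * v 0 2)
             + u 0 2 * (A 2 0 * v 0 0 + A 2 1 * v 0 1 + A 2 2 * v 0 2).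
Proof. by rewrite /bil !mxE sum_ord3 !mxE !sum_ord3; ring. Qed.

Lemma bilDl A u v w : bil A (u + v) w = bil A u w + bil A v w.
Proof. by rewrite /bil !mulmxDl mxE. Qed.

Lemma bilDr A u v w : bil A w (u + v) = bil A w u + bil A w v.
Proof. by rewrite /bil linearD /= mulmxDr mxE. Qed.

Lemma bilZl A a u w : bil A (a *: u) w = a * bil A u w.
Proof. by rewrite /bil -!scalemxAl mxE. Qed.

Lemma bilZr A a u w : bil A w (a *: u) = a * bil A w u.
Proof. by rewrite /bil linearZ /= -scalemxAr mxE. Qed.

Lemma bilC A u v : A^T = A -> bil A u v = bil A v u.
Proof.
by move=> symA; rewrite /bil -[in LHS](trmxK (u *m A)) -trmx_mul mxE trmx_mul symA mulmxA.
Qed.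

Lemma bil_mulmx A M u v : bil (M *m A *m M^T) u v = bil A (u *m M) (v *m M).
Proof. by rewrite /bil trmx_mul !mulmxA. Qed.

Lemma bil_scale A d u v : bil (d *: A) u v = d * bil A u v.
Proof. by rewrite /bil -scalemxAr -scalemxAl mxE. Qed.

Lemma bil_add A M u v : bil (A + M) u v = bil A u v + bil M u v.
Proof. by rewrite /bil mulmxDr mulmxDl mxE. Qed.

Lemma bil_tensor v u w : bil (v^T *m v) u w = (u *m v^T) 0 0 * (w *m v^T) 0 0.
Proof.
rewrite /bil mulmxA -mulmxA mxE big_ord1; congr (_ * _).
by rewrite -[v in LHS]trmxK -trmx_mul mxE.
Qed.

Lemma bil_rows A M i j : (M *m A *m M^T) i j = bil A (row i M) (row j M).
Proof.
by rewrite /bil -row_mul !mxE; apply: eq_bigr => k _; rewrite !mxE.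
Qed.

Lemma bil_unit A u : A \in unitmx -> u != 0 -> exists v, bil A u v != 0.
Proof.
move=> unitA u0; have : u *m A != 0.
  by apply: contra_neq u0 => uA; rewrite -(mulmxK unitA u) uA mul0mx.
case/rV0Pn => j uAj; exists (delta_mx 0 j).
by rewrite /bil trmx_delta -colE mxE.
Qed.

Lemma tensorE (v : 'rV[F]_3) i j : (v^T *m v) i j = v 0 i * v 0 j.
Proof. by rewrite mxE big_ord1 mxE. Qed.

Definition diag3 a b c : 'M[F]_3 := diag_mx (row3 a b c).

Lemma diag3E a b c : ((diag3 a b c 0 0 = a) * (diag3 a b c 1 1 = b) * (diag3 a b c 2 2 = c)
  * (diag3 a b c 0 1 = 0) * (diag3 a b c 0 2 = 0) * (diag3 a b c 1 2 = 0)
  * (diag3 a b c 1 0 = 0) * (diag3 a b c 2 0 = 0) * (diag3 a b c 2 1 = 0))%type.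
Proof. by rewrite !mxE /=. Qed.

Lemma scale_diag3 k a b c : k *: diag3 a b c = diag3 (k * a) (k * b) (k * c).
Proof.
by apply/matrixP; apply: ord3_ind; apply: ord3_ind; rewrite mxE !diag3E ?mulr0.
Qed.

Lemma det_diag3 a b c : \det (diag3 a b c) = a * b * c.
Proof. by rewrite det_diag !big_ord_recl big_ord0 !mxE /=; ring. Qed.

Lemma diag3_change a b c e :
  (diag3 (a + e) b c = 1 *: diag3 a b c + e *: ((row3 1 0 0)^T *m row3 1 0 0)) *
  (diag3 a (b + e) c = 1 *: diag3 a b c + e *: ((row3 0 1 0)^T *m row3 0 1 0)) *
  (diag3 a b (c + e) = 1 *: diag3 a b c + e *: ((row3 0 0 1)^T *m row3 0 0 1)).
Proof.
by do !split; apply/matrixP; apply: ord3_ind; apply: ord3_ind;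
  rewrite scale1r [RHS]mxE [(_ *: _ : 'M_3) _ _]mxE tensorE !row3E !diag3E; ring.
Qed.

Lemma tensor_sum a b c u v w :
  (mx3 u v w)^T *m diag3 a b c *m mx3 u v w =
  a *: (u^T *m u) + b *: (v^T *m v) + c *: (w^T *m w).
Proof.
apply/matrixP => i j; rewrite mxE sum_ord3 /diag3 mul_mx_diag !mxE !big_ord1 !mxE /=.
by ring.
Qed.

Lemma separating_vector v w :
  (forall k, w != k *: v) -> exists u : 'rV_3, (u *m v^T) 0 0 = 0 /\ (u *m w^T) 0 0 != 0.
Proof.
move=> wv.
have dotE (i : 'I_3) (x : 'rV[F]_3) : ((delta_mx 0 i : 'rV_3) *m x^T) 0 0 = x 0 i.
  by rewrite -rowE !mxE.
have [v0 | /rV0Pn[j vj]] := eqVneq v 0.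
  have /rV0Pn[i wi] : w != 0 by have := wv 0; rewrite scale0r.
  by exists (delta_mx 0 i); rewrite !dotE v0 mxE.
have [[i wi] | /existsPn all0] := altP (@existsP _ (fun i => v 0 j * w 0 i - v 0 i * w 0 j != 0)).
  exists (v 0 j *: delta_mx 0 i - v 0 i *: delta_mx 0 j).
  rewrite !mulmxBl -!scalemxAl ![(_ - _ : 'M_1) _ _]mxE ![(_ *: _ : 'M_1) _ _]mxE.
  rewrite ![(- _ : 'M_1) _ _]mxE ![(_ *: _ : 'M_1) _ _]mxE !dotE.
  by split=> //; rewrite mulrC subrr.
case/eqP: (wv (w 0 j / v 0 j)); apply/rowP => i; rewrite mxE; apply: (mulfI vj).
have := all0 i; rewrite negbK subr_eq0 => /eqP->; by field.
Qed.

(** A quadratic form x N x^T is given by any matrix N, symmetric or not, so as to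
    cover characteristic 2; this is the matrix of its polar bilinear form. *)
Definition polar N : 'M[F]_3 := N + N^T.

Lemma polar_sym N : (polar N)^T = polar N.
Proof. by rewrite /polar linearD /= trmxK addrC. Qed.

Lemma bil_polar N u v : bil (polar N) u v = bil N u v + bil N v u.
Proof.
rewrite /polar bil_add; congr (_ + _); rewrite /bil.
by rewrite (_ : u *m N^T *m v^T = (v *m N *m u^T)^T) ?mxE // !trmx_mul trmxK mulmxA.
Qed.

Definition nondegenerate N := forall x : 'rV_3, bil N x x = 0 -> x *m polar N = 0 -> x = 0.

Definition isotropic A r := (r != 0) && (bil A r r == 0).

Lemma isotropic_mulmx A M r :
  M \in unitmx -> isotropic (M *m A *m M^T) r = isotropic A (r *m M).
Proof.
move=> unitM; rewrite /isotropic bil_mulmx; congr (~~ _ && _).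
apply/eqP/eqP => [-> | rM]; first by rewrite mul0mx.
by rewrite -(mulmxK unitM r) rM mul0mx.
Qed.

Lemma isotropic_scale A d r : d != 0 -> isotropic (d *: A) r = isotropic A r.
Proof. by move=> d0; rewrite /isotropic bil_scale mulf_eq0 (negPf d0). Qed.

Lemma isotropic_polar N r : 2 != 0 :> F -> isotropic (polar N) r = isotropic N r.
Proof.
by move=> two0; rewrite /isotropic bil_polar -mulr2n -mulr_natl mulf_eq0 (negPf two0).
Qed.

(** The conic 2yz = x^2. *)
Definition parabola : 'M[F]_3 := \matrix_(i, j) ((i + j == 3)%N%:R - (i + j == 0)%N%:R).

Lemma bil_parabola u v :
  bil parabola u v = u 0 1 * v 0 2 + u 0 2 * v 0 1 - u 0 0 * v 0 0.
Proof. by rewrite bilE !mxE /=; ring. Qed.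

Lemma det_parabola : \det parabola = 1.
Proof.
rewrite (expand_det_row _ 0) sum_ord3 !mxE /= !subrr !mul0r !addr0 sub0r /cofactor.
rewrite (expand_det_row _ 0) !big_ord_recl big_ord0 /cofactor !det_mx11 !mxE /=.
by ring.
Qed.

End Forms.

Section ParabolaForm.
Local Open Scope ring_scope.
Variable F : fieldType.
Implicit Types (A M : 'M[F]_3) (r : 'rV[F]_3).
Hypothesis two0 : 2 != 0 :> F.

(** Take r and a second isotropic vector, on a line through r that is not the
    tangent, as second and third coordinate vectors, and a vector orthogonal to
    both as the first. *)
Lemma parabola_form A r : A^T = A -> A \in unitmx -> isotropic A r ->
  exists M d, [/\ M \in unitmx, d != 0, row 1 M = r & M *m A *m M^T = d *: parabola F].
Proof.
move=> symA unitA /andP[r0 /eqP isor].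
have [w0 rw0] := bil_unit unitA r0.
pose w := w0 - (bil A w0 w0 / (2 * bil A r w0)) *: r.
have rw : bil A r w = bil A r w0.
  by rewrite /w -scaleNr bilDr bilZr isor mulr0 addr0.
have isow : bil A w w = 0.
  rewrite {1}/w -scaleNr bilDl bilZl rw /w -scaleNr bilDr bilZr (bilC w0) //.
  by field; rewrite rw0 two0.
rewrite -{}rw in rw0; pose b := bil A r w; have rw : bil A r w = b by [].
rewrite rw in rw0.
pose B := row_mx (A *m r^T) (A *m w^T).
have [x xB x0] : exists2 x : 'rV_3, x *m B = 0 & x != 0.
  have : kermx B != 0.
    by rewrite -mxrank_eq0 mxrank_ker subn_eq0 -ltnNge (leq_ltn_trans (rank_leq_col B)).
  by case/rowV0Pn => x /sub_kermxP; exists x.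
have [xr xw] : bil A x r = 0 /\ bil A x w = 0.
  move: xB; rewrite mul_mx_row -row_mx0 => /eq_row_mx[xr xw].
  by rewrite /bil -!mulmxA xr xw !mxE.
have rx : bil A r x = 0 by rewrite bilC.
have wx : bil A w x = 0 by rewrite bilC.
have wr : bil A w r = b by rewrite bilC.
have unitM d : d != 0 -> mx3 x r (d *: w) \in unitmx.
  move=> d0; rewrite -row_free_unit -kermx_eq0; apply/rowV0P => v /sub_kermxP.
  rewrite mul_rV3 !row_mx3 scalerA => v0.
  have := congr1 (fun z => bil A z r) v0; have := congr1 (fun z => bil A z w) v0.
  have bil0 y : bil A 0 y = 0 by rewrite -(scale0r y) bilZl mul0r.
  rewrite /= !bil0 !bilDl !bilZl xr xw isor isow wr rw !mulr0 !addr0 !add0r => /eqP.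
  rewrite mulf_eq0 (negPf rw0) orbF => /eqP v1 /eqP.
  rewrite !mulf_eq0 (negPf rw0) (negPf d0) !orbF => /eqP v2.
  move: v0; rewrite v1 v2 mul0r !scale0r !addr0 => /eqP.
  by rewrite scaler_eq0 (negPf x0) orbF => /eqP v00; apply: row3P; rewrite ?v00 ?v1 ?v2 mxE.
have xx : bil A x x != 0.
  apply/eqP => xx; have := unitM 1 (oner_neq0 _); rewrite scale1r => unitM1.
  have [v] := bil_unit unitA x0.
  rewrite -(mulmxKV unitM1 v) mul_rV3 !row_mx3 !bilDr !bilZr xx xr xw.
  by rewrite !mulr0 !addr0 eqxx.
pose d := - bil A x x; have d0 : d != 0 by rewrite oppr_eq0.
exists (mx3 x r ((d / b) *: w)), d; split=> //.
- by apply: unitM; rewrite mulf_neq0 ?invr_neq0.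
- by rewrite !row_mx3.
have db : d / b * b = d by rewrite divfK.
apply/matrixP => i j; rewrite bil_rows !mxE.
elim/ord3_ind: i; elim/ord3_ind: j; rewrite !row_mx3 ?bilZl ?bilZr /=;
  rewrite ?xr ?rx ?xw ?wx ?isor ?isow ?wr ?rw ?db /d; ring.
Qed.

End ParabolaForm.

(** * Tangents of a unital *)

Section Tangents.
Local Open Scope ring_scope.
Variables (F : finFieldType) (q : nat).
Hypotheses (cardFq : #|F| = (q ^ 2)%N) (q_gt1 : (1 < q)%N).
Implicit Types (V : {set 'rV[F]_3}) (A M N : 'M[F]_3) (u v w r p c : 'rV[F]_3).

Definition scalings v : {set 'rV[F]_3} := [set k *: v | k in [set~ 0]].

Lemma card_scalings v : v != 0 -> #|scalings v| = #|F|.-1.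
Proof.
move=> v0; rewrite card_in_imset ?cardsC1 // => k l _ _ /eqP.
by rewrite -subr_eq0 -scalerBl scaler_eq0 (negPf v0) orbF subr_eq0 => /eqP.
Qed.

Lemma scalings_isotropic A v :
  isotropic A v -> scalings v \subset [set r | isotropic A r].
Proof.
move=> /andP[v0 isov]; apply/subsetP => x /imsetP[k]; rewrite in_setC1 => k0 ->.
by rewrite inE /isotropic scaler_eq0 (negPf k0) v0 bilZl bilZr !mulf_eq0 isov !orbT.
Qed.

Definition line_vectors V v := [set x in V | x *m v^T == 0].

(** The nonzero vectors on the points of a unital. *)
Definition unital_cone V : Prop :=
  [/\ 0 \notin V, forall k v, k != 0 -> (k *: v \in V) = (v \in V),
      #|V| = (#|F|.-1 * (q ^ 3 + 1))%N &
      forall v, v != 0 -> #|line_vectors V v| = #|F|.-1 \/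
                          #|line_vectors V v| = (#|F|.-1 * (q + 1))%N].

Let F1 : (0 < #|F|.-1)%N. Proof. by have := finNzRing_gt1 F; case: #|F| => [|[]]. Qed.

Lemma unital_cone_nonempty V : unital_cone V -> exists v, v \in V.
Proof.
by move=> [_ _ cardV _]; apply/card_gt0P; rewrite cardV muln_gt0 F1 addn1.
Qed.

Lemma card_kernel k (B : 'M[F]_(3, k)) :
  #|[set c : 'rV_3 | c *m B == 0]| = (#|F| ^ (3 - \rank B))%N.
Proof.
rewrite -mxrank_ker -card_rowg; congr #|pred_of_set _|; apply/setP => c.
by rewrite !inE; apply/eqP/sub_kermxP.
Qed.

Lemma scalings_sub V r c : unital_cone V ->
  r \in line_vectors V c -> scalings r \subset line_vectors V c.
Proof.
move=> [_ VZ _ _]; rewrite inE => /andP[rV /eqP rc]; apply/subsetP => x /imsetP[k].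
by rewrite in_setC1 => k0 ->; rewrite inE VZ // rV -scalemxAl rc scaler0 eqxx.
Qed.

(** Otherwise each of the q^2 + 1 lines through r has q further points of the
    unital, which makes more than q^3 of them. Pairs of a line c through r and a
    vector y of V on it are counted in two ways. *)
Lemma tangent_exists V r : unital_cone V -> r \in V ->
  exists c, line_vectors V c = scalings r.
Proof.
move=> uniV rV; have [V0 VZ cardV lines] := uniV.
have r0 : r != 0 by apply: contraNneq V0 => <-.
have [/existsP[c /eqP] | /existsPn full] :=
  boolP [exists c : 'rV[F]_3, line_vectors V c == scalings r]; first by exists c.
pose K := [set c : 'rV[F]_3 | (c != 0) && (r *m c^T == 0)].
pose Y := V :\: scalings r.
have mulC (x c : 'rV[F]_3) : (x *m c^T == 0) = (c *m x^T == 0).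
  by rewrite -[x *m c^T]trmxK trmx_mul trmxK -(inj_eq trmx_inj) trmxK trmx0.
have cardK : #|K| = (#|F| ^ 2 - 1)%N.
  have -> : K = [set c : 'rV[F]_3 | c *m r^T == 0] :\ 0.
    by apply/setP => c; rewrite !inE mulC.
  have := cardsD1 0 [set c : 'rV[F]_3 | c *m r^T == 0].
  rewrite inE mul0mx eqxx card_kernel mxrank_tr rank_rV r0 /= => ->.
  by rewrite add1n subn1.
have left_sum : (\sum_(c in K) #|[set y in Y | y *m c^T == 0%R]| =
    (#|F| ^ 2 - 1) * (#|F|.-1 * q))%N.
  rewrite -cardK -sum_nat_const; apply: eq_bigr => c; rewrite inE => /andP[c0 rc].
  have scr : scalings r \subset line_vectors V c.
    by apply: scalings_sub => //; rewrite inE rV.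
  have -> : [set y in Y | y *m c^T == 0] = line_vectors V c :\: scalings r.
    by apply/setP => y; rewrite !inE andbA.
  rewrite cardsD (setIidPr scr) card_scalings //.
  case: (lines c c0) => e; last by rewrite e mulnDr muln1 addnK.
  by have := full c; rewrite eq_sym eqEcard scr e card_scalings // leqnn.
have right_sum : (\sum_(c in K) #|[set y in Y | y *m c^T == 0%R]| = #|Y| * #|F|.-1)%N.
  rewrite -sum_nat_const.
  under eq_bigr => c _ do rewrite -sum1dep_card.
  rewrite (exchange_big_dep (mem Y)) /=; last by move=> c y _ /andP[].
  apply: eq_bigr => y yY; rewrite sum1dep_card.
  have -> : [set c in K | (y \in Y) && (y *m c^T == 0)] =
      [set c : 'rV[F]_3 | c *m row_mx r^T y^T == 0] :\ 0.
    apply/setP => c; rewrite in_set [c \in K]inE yY /= in_setD1 in_set -andbA.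
    by rewrite (mulC r) (mulC y) mul_mx_row row_mx_eq0.
  have := cardsD1 0 [set c : 'rV[F]_3 | c *m row_mx r^T y^T == 0].
  rewrite inE mul0mx eqxx card_kernel.
  have -> : \rank (row_mx r^T y^T) = 2%N.
    rewrite -mxrank_tr tr_row_mx !trmxK; apply/eqP; rewrite -[_ == _]/(row_free (col_mx r y)).
    rewrite -kermx_eq0; apply/rowV0P => x /sub_kermxP.
    rewrite -[x]hsubmxK mul_row_col; set a := lsubmx x; set b := rsubmx x.
    rewrite [a]mx11_scalar [b]mx11_scalar !mul_scalar_mx.
    move: (a 0 0) (b 0 0) => a' b' e; have [b0 | b0] := eqVneq b' 0.
      move/eqP: e; rewrite b0 scale0r addr0 scaler_eq0 (negPf r0) orbF => /eqP->.
      by rewrite !raddf0 row_mx0.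
    have yr : y = (- a' / b') *: r.
      apply: (scalerI b0); rewrite scalerA mulrC divfK // scaleNr.
      by apply/eqP; rewrite -addr_eq0 addrC e.
    move: yY; rewrite in_setD => /andP[yN yV]; case/negP: yN; rewrite yr in yV *.
    apply/imsetP; exists (- a' / b') => //; rewrite in_setC1.
    by apply: contraNneq V0 => a0; rewrite a0 scale0r in yV.
  by rewrite expn1 => ->.
move: left_sum; rewrite right_sum cardsD (setIidPr _); last first.
  by apply/subsetP => x /imsetP[k]; rewrite in_setC1 => k0 ->; rewrite VZ.
rewrite card_scalings // cardV mulnDr muln1 addnK => e.
have : (#|F|.-1 * #|F|.-1 * q ^ 3 = #|F|.-1 * #|F|.-1 * (q ^ 3 + q))%N.
  have -> : (#|F|.-1 * #|F|.-1 * q ^ 3 = (#|F| ^ 2 - 1 ^ 2) * (#|F|.-1 * q))%N.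
    by rewrite exp1n -e mulnAC.
  rewrite subn_sqr subn1 expnS -cardFq addn1 -mulnSr.
  by rewrite -!mulnA; congr (_ * _)%N; rewrite mulnCA; congr (_ * _)%N; rewrite mulnC.
move/eqP; rewrite eqn_pmul2l ?muln_gt0 ?F1 // -{1}[(q ^ 3)%N]addn0 eqn_add2l => /eqP q0.
by move: q_gt1; rewrite -q0.
Qed.

(** A line through r on which the polar form of r does not vanish contains a second
    point of the conic, which is a point of V. *)
Lemma quadratic_tangent V N r c :
  (forall x, isotropic N x -> x \in V) -> isotropic N r ->
  line_vectors V c = scalings r -> exists k, r *m polar N = k *: c.
Proof.
move=> inV /andP[r0 /eqP rr] Lr.
have rc : r *m c^T = 0.
  have : r \in line_vectors V c.
    rewrite Lr; apply/imsetP; exists 1; last by rewrite scale1r.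
    by rewrite in_setC1 oner_neq0.
  by rewrite inE => /andP[_ /eqP].
have [/existsP[k /eqP rSk] | /existsPn sepk] := boolP [exists k, r *m polar N == k *: c].
  by exists k.
have [w [wc wrS]] := separating_vector sepk.
have rw : bil (polar N) r w != 0.
  by move: wrS; rewrite trmx_mul polar_sym mulmxA -[_ 0 0]/(bil (polar N) w r) bilC ?polar_sym.
set b := bil _ r w in rw.
(* the second point of the conic on the line through r and w *)
pose w' := b *: w - bil N w w *: r.
have rS : bil (polar N) r r = 0 by rewrite bil_polar rr addr0.
have rw' : bil (polar N) r w' = b ^+ 2.
  by rewrite /w' -scaleNr bilDr !bilZr rS mulr0 addr0.
have isow' : isotropic N w'.
  apply/andP; split.
    apply: contra_neq (expf_neq0 2 rw) => w'0.
    by rewrite -rw' w'0 -(scale0r r) bilZr mul0r.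
  rewrite /w' -scaleNr bilDl !bilDr !bilZl !bilZr rr; apply/eqP.
  by have := bil_polar N r w; rewrite -/b => ->; ring.
have : w' \in scalings r.
  rewrite -Lr inE inV // mulmxBl -!scalemxAl rc scaler0 subr0 /=.
  apply/eqP/matrixP => i j; rewrite (ord1 i) (ord1 j) [LHS]mxE [in LHS]wc mulr0.
  by rewrite mxE.
case/imsetP => k _ w'E; move: (expf_neq0 2 rw).
by rewrite -rw' w'E bilZr rS mulr0 eqxx.
Qed.

(** The tangent of V at a point r of a conic in V meets the conic in r only, so
    it is the tangent of the conic. *)
Lemma quadratic_inscribed V N : unital_cone V -> nondegenerate N ->
  (forall x, isotropic N x -> x \in V) ->
  forall r w, isotropic N r -> w \in V -> bil (polar N) r w = 0 -> exists k, w = k *: r.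
Proof.
move=> uniV nsN inV r w isor wV rw.
have [c Lr] := tangent_exists uniV (inV r isor).
have [k rS] := quadratic_tangent inV isor Lr.
have k0 : k != 0.
  case/andP: (isor) => r0 /eqP rr; apply: contra_neq r0 => k0.
  by apply: nsN; rewrite // rS k0 scale0r.
suff : w \in scalings r by case/imsetP => l _ ->; exists l.
rewrite -Lr inE wV /= -(inj_eq trmx_inj) trmx_mul trmxK trmx0.
rewrite -(inj_eq (scalerI k0)) scaler0 scalemxAl -rS.
by apply/eqP/matrixP => i j; rewrite (ord1 i) (ord1 j) [RHS]mxE -rw.
Qed.

(** The polar form is alternating, hence singular: some p, the nucleus, is
    orthogonal to all vectors. For y in V the vector r = y + s p is isotropic for a
    suitable s, since every element of F is a square, and y is on the tangent at r.
    So V consists of isotropic vectors. By nondegeneracy these inject into the image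
    of the polar form, which has dimension at most 2. *)
Lemma even_no_conic V N : 2 = 0 :> F -> unital_cone V -> nondegenerate N ->
  (forall x, isotropic N x -> x \in V) -> ~ exists r, isotropic N r.
Proof.
move=> two0 uniV nsN inV [r0 iso0]; have [_ _ cardV _] := uniV.
have tgV := quadratic_inscribed uniV nsN inV.
have symS := polar_sym N; have SE := bil_polar N.
set S := polar N in nsN tgV symS SE.
have dbl (x : F) : x + x = 0 by rewrite -mulr2n -mulr_natl two0 mul0r.
have [p p0 pS] : exists2 p : 'rV_3, p != 0 & p *m S = 0.
  pose p := row3 (S 1 2) (S 0 2) (S 0 1).
  have Sd i : S i i = 0 by rewrite !mxE dbl.
  have Ss i j : S i j = S j i by rewrite -{1}symS mxE.
  have pS : p *m S = 0.
    rewrite /p; apply: row3P; rewrite mxE sum_ord3 !row3E ?Sd [RHS]mxE.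
    - by rewrite (Ss 1 0) (Ss 2 0) mulr0 add0r mulrC dbl.
    - by rewrite (Ss 2 1) mulr0 addr0 mulrC dbl.
    - by rewrite mulr0 addr0 mulrC dbl.
  have [p0 | p0] := eqVneq p 0; last by exists p.
  (* if p = 0 then the first row of S is zero *)
  exists (row3 1 0 0); first by rewrite row3_neq0 ?oner_neq0.
  have S01 : S 0 1 = 0 by transitivity (p 0 2); [rewrite row3E | rewrite p0 mxE].
  have S02 : S 0 2 = 0 by transitivity (p 0 1); [rewrite row3E | rewrite p0 mxE].
  by apply: row3P; rewrite mxE sum_ord3 !row3E [RHS]mxE !mul0r !addr0 mul1r ?Sd ?S01 ?S02.
have Sp x : bil S x p = 0 by rewrite bilC // /bil pS mul0mx mxE.
have Np : bil N p p != 0 by apply/eqP => Np; case/eqP: p0; apply: nsN Np pS.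
have [k Fk] : exists k, #|F| = (2 * k)%N.
  exists #|F|./2; rewrite -[LHS]odd_double_half mul2n; have := natr_card F.
  rewrite -{1}[#|F|]odd_double_half -mul2n natrD natrM two0 mul0r addr0.
  by case: odd => // /eqP; rewrite oner_eq0.
have conicV y : y \in V -> bil N y y = 0.
  move=> yV; pose s := (bil N y y / bil N p p) ^+ k.
  have sE : s ^+ 2 = bil N y y / bil N p p by rewrite -exprM mulnC -Fk expf_card.
  pose r := y + s *: p.
  have Nr : bil N r r = 0.
    rewrite /r bilDl !bilDr !bilZl !bilZr.
    have Nyp : bil N p y = - bil N y p by apply/eqP; rewrite -addr_eq0 addrC -SE Sp.
    have -> : s * (s * bil N p p) = bil N y y by rewrite mulrA -expr2 sE divfK.
    by rewrite Nyp; transitivity (bil N y y + bil N y y); [ring | apply: dbl].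
  have Sr : bil S r y = 0.
    by rewrite /r bilDl bilZl SE dbl (bilC p) // Sp mulr0 addr0.
  have [r1 | r1] := eqVneq r 0; last first.
    have [|c ->] := tgV r y _ yV Sr; first by rewrite /isotropic r1 Nr eqxx.
    by rewrite bilZl bilZr Nr !mulr0.
  (* y is the nucleus, which lies on the tangent at r0 *)
  have yE : y = - s *: p by apply/eqP; rewrite scaleNr -addr_eq0 -/r r1.
  have [|c ->] := tgV r0 y iso0 yV; first by rewrite yE bilZr Sp mulr0.
  by case/andP: iso0 => _ /eqP Nr0; rewrite bilZl bilZr Nr0 !mulr0.
have injS : {in V &, injective (fun y => y *m S)}.
  move=> x y xV yV /= e; apply/eqP; rewrite -subr_eq0; apply/eqP/nsN.
    have Sxy : bil S x y = 0 by rewrite /bil e -[_ 0 0]/(bil S y y) SE dbl.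
    rewrite -scaleN1r bilDl !bilDr !bilZl !bilZr !conicV //.
    by move: Sxy; rewrite SE => Sxy; rewrite !mulr0 addr0 add0r -mulrDr Sxy mulr0.
  by rewrite mulmxBl e subrr.
have : (#|V| <= #|F| ^ 2)%N.
  rewrite -(card_in_imset injS).
  have rkS : (\rank S <= 2)%N.
    rewrite -ltnS ltn_neqAle rank_leq_row andbT; apply/negP => rk.
    by case/eqP: p0; apply: (row_free_inj rk); rewrite pS mul0mx.
  apply: (@leq_trans #|rowg S|).
    apply/subset_leq_card/subsetP => _ /imsetP[y _ ->].
    by rewrite inE submxMl.
  by rewrite card_rowg leq_pexp2l // ltnW // finNzRing_gt1.
rewrite cardV leqNgt => /negP[]; rewrite cardFq.
have q2 : (q ^ 2 = (q ^ 2).-1.+1)%N by rewrite prednK // expn_gt0 ltnW.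
have le1 : (3 * q ^ 2 <= 4 * (q ^ 2).-1)%N.
  have : (4 <= q ^ 2)%N by rewrite (@leq_exp2r 2 _ 2).
  by rewrite {1 2}q2; move: (q ^ 2).-1 => d; clear; lia.
have le2 : (2 * q ^ 2 <= q ^ 3)%N by rewrite [X in (_ <= X)%N]expnS leq_mul2r q_gt1 orbT.
move: (q ^ 2)%N (q ^ 3)%N q2 le1 le2 => a b a1 le1 le2.
clear -a1 le1 le2; nia.
Qed.

End Tangents.

(** * Conics inscribed in a set *)

Section Inscribed.
Local Open Scope ring_scope.
Variable F : finFieldType.
Implicit Types (V : {set 'rV[F]_3}) (A M N : 'M[F]_3) (u v w r : 'rV[F]_3).

(** By [quadratic_inscribed] these conditions hold for the conics in a unital; the
    comparison of two conics relies on them alone. *)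
Definition inscribed V A :=
  [/\ A^T = A, A \in unitmx, exists r, isotropic A r,
      forall r, isotropic A r -> r \in V &
      forall r w, isotropic A r -> w \in V -> bil A r w = 0 -> exists c, w = c *: r].

Lemma inscribed_mulmx V A M : M \in unitmx -> inscribed V A ->
  inscribed [set x | x *m M \in V] (M *m A *m M^T).
Proof.
move=> unitM [symA unitA [r isor] inV tgV]; split.
- by rewrite !trmx_mul trmxK symA mulmxA.
- by rewrite !unitmx_mul unitmx_tr unitM unitA.
- by exists (r *m invmx M); rewrite isotropic_mulmx // mulmxKV.
- by move=> x; rewrite isotropic_mulmx // inE; apply: inV.
move=> x w; rewrite isotropic_mulmx // inE bil_mulmx => isox wV xw.
have [c wx] := tgV _ _ isox wV xw; exists c.
by apply: (can_inj (mulmxK unitM)); rewrite wx scalemxAl.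
Qed.

Lemma inscribed_scale V A d : d != 0 -> inscribed V A -> inscribed V (d *: A).
Proof.
move=> d0 [symA unitA [r isor] inV tgV]; split.
- by rewrite linearZ /= symA.
- by rewrite unitmxZ // unitfE.
- by exists r; rewrite isotropic_scale.
- by move=> x; rewrite isotropic_scale //; apply: inV.
move=> x w; rewrite isotropic_scale // bil_scale => isox wV /eqP.
by rewrite mulf_eq0 (negPf d0) => /eqP; apply: tgV.
Qed.

Lemma polar_inscribed q V N : #|F| = (q ^ 2)%N -> (1 < q)%N -> 2 != 0 :> F ->
  unital_cone q V -> nondegenerate N -> (forall x, isotropic N x -> x \in V) ->
  (exists r, isotropic N r) -> inscribed V (polar N).
Proof.
move=> cardFq q_gt1 two0 uniV nsN inV [r isor]; split.
- exact: polar_sym.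
- rewrite -row_free_unit -kermx_eq0; apply/rowV0P => x /sub_kermxP xS.
  apply: nsN => //; apply: (mulfI two0).
  by rewrite mulr0 mulr_natl mulr2n -bil_polar /bil xS mul0mx mxE.
- by exists r; rewrite isotropic_polar.
- by move=> x; rewrite isotropic_polar //; apply: inV.
move=> x w; rewrite isotropic_polar //.
exact: (quadratic_inscribed cardFq q_gt1 uniV nsN inV).
Qed.

Definition covered V := forall v, v \in V -> exists A, inscribed V A /\ isotropic A v.

Lemma covered_mulmx V M : M \in unitmx -> covered V -> covered [set x | x *m M \in V].
Proof.
move=> unitM coverV x; rewrite inE => /coverV[A [insA isox]].
exists (M *m A *m M^T); split; first exact: inscribed_mulmx.
by rewrite isotropic_mulmx.
Qed.

Lemma card_mulmx V M : M \in unitmx -> #|[set x | x *m M \in V]| = #|V|.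
Proof.
move=> unitM; rewrite -(card_imset _ (can_inj (mulmxK unitM))); congr #|pred_of_set _|.
apply/setP => y; apply/imsetP/idP => [[x] | yV].
  by rewrite inE => xV ->.
by exists (y *m invmx M); rewrite ?inE mulmxKV.
Qed.

End Inscribed.

Section InscribedPairs.
Local Open Scope ring_scope.
Variables (F : finFieldType) (n : nat).
Hypotheses (cardF : #|F| = (2 * n).+1) (n_even : ~~ odd n).
Implicit Types (V : {set 'rV[F]_3}) (A M : 'M[F]_3) (u v w r : 'rV[F]_3).
Let two0 : 2 != 0 :> F := two_neq0 cardF.

Lemma nsqN (x : F) : nsq n (- x) = nsq n x.
Proof. by rewrite /nsq exprNn -signr_odd (negPf n_even) mul1r. Qed.

Lemma sqrt_m1 : exists i : F, i ^+ 2 = -1.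
Proof.
have [|i iE] := @not_nsq_sqr _ n cardF (-1); last by exists i.
by rewrite nsqN /nsq expr1n -addr_eq0.
Qed.

(** If the value were a square, the discriminant of the polar line of w would be
    one as well, the polar line would meet the conic, and w would be on the
    tangent at the point of intersection. *)
Lemma inscribed_nsq V A w : inscribed V A -> w \in V -> bil A w w != 0 ->
  nsq n (bil A w w * \det A).
Proof.
move=> [symA unitA [r isor] inV tgV] wV ww; apply/contraT => /(not_nsq_sqr cardF)[s sE].
have [i iE] := sqrt_m1.
have [M [d [unitM d0 _ MA]]] := parabola_form two0 symA unitA isor.
have wE : w *m invmx M *m M = w by rewrite mulmxKV.
set x := w *m invmx M in wE.
have bilx u : bil A (u *m M) w = d * bil (parabola F) u x.
  by rewrite -wE -bil_mulmx MA bil_scale.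
have detA : \det A * \det M ^+ 2 = d ^+ 3.
  have := congr1 determinant MA; rewrite detZ det_parabola mulr1 !det_mulmx det_tr => <-.
  by ring.
have px : bil (parabola F) x x = (s * \det M / d ^+ 2) ^+ 2.
  apply: (mulfI (expf_neq0 4 d0)).
  have -> : d ^+ 4 * bil (parabola F) x x = d * bil (parabola F) x x * d ^+ 3 by ring.
  rewrite -bilx wE -detA mulrA sE.
  by field.
set e := s * _ / _ in px.
suff [y isoy yx] : exists2 y, isotropic (parabola F) y & bil (parabola F) y x = 0.
  have isoyM : isotropic A (y *m M).
    by rewrite -isotropic_mulmx // MA isotropic_scale.
  have [|c wc] := tgV _ _ isoyM wV; first by rewrite bilx yx mulr0.
  by move: ww; rewrite wc bilZl bilZr; case/andP: isoyM => _ /eqP->; rewrite !mulr0 eqxx.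
have [x2 | x2] := eqVneq (x 0 2) 0.
  exists (row3 0 1 0); last by rewrite bil_parabola !row3E x2; ring.
  rewrite /isotropic bil_parabola !row3E; apply/andP; split; last by apply/eqP; ring.
  by apply: contra_neq (oner_neq0 F) => /rowP/(_ 1); rewrite row3E mxE.
pose t := (x 0 0 + i * e) / x 0 2.
exists (row3 t (t ^+ 2 / 2) 1).
  rewrite /isotropic bil_parabola !row3E; apply/andP; split; last by apply/eqP; field.
  by apply: contra_neq (oner_neq0 F) => /rowP/(_ 2); rewrite row3E mxE.
have ie : (i * e) ^+ 2 = x 0 0 ^+ 2 - 2 * x 0 1 * x 0 2.
  by rewrite exprMn iE -px bil_parabola; ring.
rewrite bil_parabola !row3E /t.
rewrite (_ : _ + _ - _ = ((i * e) ^+ 2 - (x 0 0 ^+ 2 - 2 * x 0 1 * x 0 2)) / (2 * x 0 2)).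
  by rewrite ie subrr mul0r.
by field; rewrite two0 x2.
Qed.

(** The points of a conic span the plane. *)
Lemma isotropic_off_line A v : A^T = A -> A \in unitmx -> (exists r, isotropic A r) ->
  v != 0 -> exists2 w, isotropic A w & (w *m v^T) 0 0 != 0.
Proof.
move=> symA unitA [r isor] v0.
have [M [d [unitM d0 _ MA]]] := parabola_form two0 symA unitA isor.
have isoM x : isotropic (parabola F) x -> isotropic A (x *m M).
  by move=> isox; rewrite -isotropic_mulmx // MA isotropic_scale.
pose y := v *m M^T.
have wvE x : (x *m M *m v^T) 0 0 = x 0 0 * y 0 0 + x 0 1 * y 0 1 + x 0 2 * y 0 2.
  have Mv : M *m v^T = y^T by rewrite /y trmx_mul trmxK.
  by rewrite -mulmxA Mv mxE sum_ord3 ![y^T _ _]mxE.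
have y0 : y != 0.
  by apply: contra_neq v0 => y0;
    rewrite -(mulmxK (_ : M^T \in unitmx) v) ?unitmx_tr // -/y y0 mul0mx.
have onP a b c : 2 * b * c = a ^+ 2 -> (a != 0) || (b != 0) || (c != 0) ->
    a * y 0 0 + b * y 0 1 + c * y 0 2 != 0 ->
    exists2 w, isotropic A w & (w *m v^T) 0 0 != 0.
  move=> bc abc yn; exists (row3 a b c *m M); last by rewrite wvE !row3E.
  apply: isoM; rewrite /isotropic bil_parabola !row3E; apply/andP; split.
    apply: contraTneq abc => /rowP e; have := e 0; have := e 1; have := e 2.
    by rewrite !row3E !mxE => -> -> ->; rewrite eqxx.
  by rewrite subr_eq0 -expr2 -bc; apply/eqP; ring.
have [y1 | y1] := eqVneq (y 0 1) 0; last first.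
  by apply: (onP 0 1 0); rewrite ?oner_eq0 ?orbT // ?mul0r ?mul1r ?addr0 ?add0r //; ring.
have [y2 | y2] := eqVneq (y 0 2) 0; last first.
  by apply: (onP 0 0 1); rewrite ?oner_eq0 ?orbT // ?mul0r ?mul1r ?addr0 ?add0r //; ring.
apply: (onP 1 2^-1 1); rewrite ?oner_eq0 //; first by field.
rewrite y1 y2 !mulr0 !addr0 mul1r; apply: contra_neq y0 => y00.
by apply: row3P; rewrite ?y00 ?y1 ?y2 mxE.
Qed.

(** On a line through r that is tangent to the conic of A but not to that of A',
    the second point of the latter conic would be a point of V on a tangent of the
    former. *)
Lemma inscribed_common_tangent V A A' r : inscribed V A -> inscribed V A' ->
  isotropic A r -> isotropic A' r -> exists c, forall w, bil A' r w = c * bil A r w.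
Proof.
move=> [symA unitA _ _ tgV] [symA' unitA' _ inV' _] isor isor'.
have sub w : bil A r w = 0 -> bil A' r w = 0.
  move=> rw; apply/eqP/contraT => rw'.
  pose w' := w - (bil A' w w / (2 * bil A' r w)) *: r.
  case/andP: (isor) => r0 /eqP rr; case/andP: (isor') => _ /eqP rr'.
  have rw'E : bil A' r w' = bil A' r w.
    by rewrite /w' -scaleNr bilDr bilZr rr' mulr0 addr0.
  have isow' : isotropic A' w'.
    apply/andP; split.
      by apply: contra_neq rw' => w'0; rewrite -rw'E w'0 -(scale0r r) bilZr mul0r.
    rewrite {1}/w' -scaleNr bilDl bilZl rw'E /w' -scaleNr bilDr bilZr (bilC w) //.
    by apply/eqP; field; rewrite rw' two0.
  have [|c w'r] := tgV _ _ isor (inV' _ isow').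
    by rewrite /w' -scaleNr bilDr bilZr rr mulr0 addr0.
  by move: rw'; rewrite -rw'E w'r bilZr rr' mulr0 eqxx.
have [w rw] := bil_unit unitA (andP isor).1.
exists (bil A' r w / bil A r w).
move=> u; have /sub : bil A r (u - (bil A r u / bil A r w) *: w) = 0.
  by rewrite -scaleNr bilDr bilZr; field.
rewrite -scaleNr bilDr bilZr => /eqP; rewrite mulNr subr_eq0 => /eqP->.
by field.
Qed.

(** Each conic has a point off the line v, and so off the other conic;
    [inscribed_nsq] applies to it. *)
Lemma inscribed_nsq_diff V A A' c e v : inscribed V A -> inscribed V A' ->
  A = c *: A' + e *: (v^T *m v) -> c != 0 -> e != 0 -> v != 0 ->
  nsq n (e * \det A) /\ nsq n (c * e * \det A').
Proof.
move=> insA insA' AE c0 e0 v0.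
have [symA unitA isoA inV _] := insA; have [symA' unitA' isoA' inV' _] := insA'.
split.
  have [w isow wv] := isotropic_off_line symA' unitA' isoA' v0.
  have ww : bil A w w = (w *m v^T) 0 0 ^+ 2 * e.
    rewrite AE bil_add !bil_scale bil_tensor.
    by case/andP: isow => _ /eqP->; rewrite mulr0 add0r mulrC expr2.
  rewrite -(nsq_sqrM cardF _ wv) mulrA -ww; apply: (inscribed_nsq insA (inV' _ isow)).
  by rewrite ww mulf_neq0 ?expf_neq0.
have [w isow wv] := isotropic_off_line symA unitA isoA v0.
have ww : bil A' w w = - (((w *m v^T) 0 0 / c) ^+ 2 * (c * e)).
  apply: (mulfI c0); rewrite -bil_scale.
  have -> : c *: A' = A + (- e) *: (v^T *m v) by rewrite AE scaleNr addrK.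
  rewrite bil_add bil_scale bil_tensor.
  by case/andP: isow => _ /eqP->; rewrite add0r; field.
have wc : (w *m v^T) 0 0 / c != 0 by rewrite mulf_neq0 ?invr_neq0.
rewrite -(nsq_sqrM cardF _ wc) mulrA -nsqN -mulNr -ww.
apply: (inscribed_nsq insA' (inV _ isow)).
by rewrite ww oppr_eq0 mulf_neq0 ?expf_neq0 // mulf_neq0.
Qed.

End InscribedPairs.

(** * The pencil spanned by two inscribed conics *)

Section Pencils.
Local Open Scope ring_scope.
Variables (F : finFieldType) (n : nat).
Hypotheses (cardF : #|F| = (2 * n).+1) (n_even : ~~ odd n) (n_ge4 : (4 <= n)%N).
Implicit Types (V : {set 'rV[F]_3}) (A G M : 'M[F]_3) (u v w r : 'rV[F]_3).
Let two0 : 2 != 0 :> F := two_neq0 cardF.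

(** The hypotheses say that on the points (s, s^2/2, 1) of the parabola G and the
    double line e v^2 have the same quartic in s. *)
Lemma parabola_pencil G v e : G^T = G ->
  G 0 0 + G 1 2 = e * (v 0 0 ^+ 2 + v 0 1 * v 0 2) -> G 1 1 = e * v 0 1 ^+ 2 ->
  G 2 2 = e * v 0 2 ^+ 2 -> G 0 1 = e * (v 0 0 * v 0 1) ->
  G 0 2 = e * (v 0 0 * v 0 2) ->
  G = (G 1 2 - e * (v 0 1 * v 0 2)) *: parabola F + e *: (v^T *m v).
Proof.
move=> symG e00 e11 e22 e01 e02.
have sG i j : G i j = G j i by rewrite -{1}symG mxE.
apply/matrixP => i j; rewrite !mxE big_ord1 !mxE.
elim/ord3_ind: i; elim/ord3_ind: j => /=.
- by rewrite -[G 0 0](addrK (G 1 2)) e00; ring.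
- by rewrite e01; ring.
- by rewrite e02; ring.
- by rewrite sG e01; ring.
- by rewrite e11; ring.
- by ring.
- by rewrite sG e02; ring.
- by rewrite sG; ring.
- by rewrite e22; ring.
Qed.

Let pt (s : F) := row3 s (s ^+ 2 / 2) 1.

Lemma isotropic_pt s : isotropic (parabola F) (pt s).
Proof.
rewrite /isotropic bil_parabola !row3E row3_neq0 ?oner_neq0 ?orbT //=.
by apply/eqP; field.
Qed.

Lemma isotropic_inf : isotropic (parabola F) (row3 0 1 0).
Proof.
rewrite /isotropic bil_parabola !row3E row3_neq0 ?oner_neq0 ?orbT //=.
by apply/eqP; ring.
Qed.

Lemma bil_pt G s : G^T = G -> bil G (pt s) (pt s) =
  4^-1 * G 1 1 * s ^+ 4 + G 0 1 * s ^+ 3 + (G 0 0 + G 1 2) * s ^+ 2 + 2 * G 0 2 * s + G 2 2.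
Proof.
move=> symG; have sG i j : G i j = G j i by rewrite -{1}symG mxE.
rewrite bilE !row3E (sG 1 0) (sG 2 0) (sG 2 1); field.
by rewrite (natrM F 2 2) mulf_neq0.
Qed.

Lemma isotropic_pt_eq G s : isotropic G (pt s) = (bil G (pt s) (pt s) == 0).
Proof. by rewrite /isotropic (andP (isotropic_pt s)).1. Qed.

(** The common point being at infinity, the quartic of G has degree at most 2 by
    [inscribed_common_tangent]. If it has a zero s then the zero is double, again
    because the conics touch there; otherwise it takes nonsquare values only, and
    it is constant. *)
Lemma touching_parabola V G : inscribed V G -> inscribed V (parabola F) ->
  isotropic G (row3 0 1 0) -> exists (c e : F) v, G = c *: parabola F + e *: (v^T *m v).
Proof.
move=> insG insP isoI; have [symG _ _ _ _] := insG.
have sG i j : G i j = G j i by rewrite -{1}symG mxE.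
have [c0 tgI] := inscribed_common_tangent cardF insP insG isotropic_inf isoI.
have simp := (mul0r, mulr0, mul1r, mulr1, add0r, addr0, subr0, oppr0).
have G01 : G 0 1 = 0.
  by have := tgI (row3 1 0 0); rewrite bil_parabola bilE !row3E sG !simp.
have G11 : G 1 1 = 0.
  by have := tgI (row3 0 1 0); rewrite bil_parabola bilE !row3E !simp.
pose a := G 0 0 + G 1 2.
have [[s /eqP fs0] | nz] := altP (@existsP _ (fun s => bil G (pt s) (pt s) == 0)).
  have isos : isotropic G (pt s) by rewrite isotropic_pt_eq fs0.
  have [c1 /(_ (row3 1 s 0))] :=
    inscribed_common_tangent cardF insP insG (isotropic_pt s) isos.
  rewrite bil_parabola bilE !row3E (sG 1 0) G11 (sG 2 0) (sG 2 1) G01 => tgs.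
  have G02 : G 0 2 = - (a * s).
    move/eqP: tgs; rewrite -subr_eq0 => /eqP tgs; apply/eqP.
    by rewrite -subr_eq0 -tgs /a; apply/eqP; field.
  have G22 : G 2 2 = a * s ^+ 2.
    have := bil_pt s symG; rewrite fs0 G11 G01 G02 -/a !simp => e; apply/eqP.
    by rewrite -subr_eq0 e; apply/eqP; ring.
  exists (G 1 2 - a * (0 * - s)), a, (row3 1 0 (- s)).
  have := parabola_pencil (v := row3 1 0 (- s)) (e := a) symG; rewrite !row3E; apply.
  - by rewrite -/a; ring.
  - by rewrite G11; ring.
  - by rewrite G22; ring.
  - by rewrite G01; ring.
  - by rewrite G02; ring.
pose f : {poly F} := \det G *: (a *: 'X^2 + (2 * G 0 2) *: 'X + (G 2 2)%:P).
have [|s|c fc] := @quadratic_nonsquare_const _ n cardF f.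
- apply/leq_sizeP => -[|[|[|i]]] // _.
  by rewrite /f !coefE /= !simp.
- have -> : f.[s] = bil G (pt s) (pt s) * \det G.
    by rewrite bil_pt // G11 G01 !(hornerZ, hornerD, hornerXn, hornerX, hornerC) /a; ring.
  apply: (inscribed_nsq cardF n_even insG); last first.
    by move/existsPn: nz => /(_ s).
  have [_ _ _ inV _] := insP; apply: inV; exact: isotropic_pt.
have D0 : \det G != 0 by have [_ + _ _ _] := insG; rewrite unitmxE unitfE.
have a0 : a = 0.
  have := congr1 (fun g : {poly F} => g`_2) fc; rewrite /= !coefE /= !simp => /eqP.
  by rewrite mulf_eq0 (negPf D0) => /eqP.
have G02 : G 0 2 = 0.
  have := congr1 (fun g : {poly F} => g`_1) fc; rewrite /= !coefE /= !simp => /eqP.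
  by rewrite !mulf_eq0 (negPf D0) (negPf two0) => /eqP.
exists (G 1 2 - G 2 2 * (0 * 1)), (G 2 2), (row3 0 0 1).
have := parabola_pencil (v := row3 0 0 1) (e := G 2 2) symG; rewrite !row3E; apply.
- by rewrite -/a a0; ring.
- by rewrite G11; ring.
- by ring.
- by rewrite G01; ring.
- by rewrite G02; ring.
Qed.

(** The quartic of G has no zeros, so [quartic_nonsquare_sqr] applies to it. *)
Lemma disjoint_parabola V G : inscribed V G -> inscribed V (parabola F) ->
  (forall r, isotropic (parabola F) r -> ~~ isotropic G r) ->
  exists (c e : F) v, G = c *: parabola F + e *: (v^T *m v).
Proof.
move=> insG insP disj; have [symG unitG _ _ _] := insG.
have four0 : 4 != 0 :> F by rewrite (natrM F 2 2) mulf_neq0.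
have D0 : \det G != 0 by move: unitG; rewrite unitmxE unitfE.
have G11 : G 1 1 != 0.
  have := disj _ isotropic_inf; rewrite /isotropic (andP isotropic_inf).1 bilE !row3E.
  by rewrite !(mul0r, mulr0, addr0, add0r, mul1r, mulr1).
pose f : {poly F} := \det G *: ((4^-1 * G 1 1) *: 'X^4 + G 0 1 *: 'X^3
  + (G 0 0 + G 1 2) *: 'X^2 + (2 * G 0 2) *: 'X + (G 2 2)%:P).
have cf i : f`_i = [:: \det G * G 2 2; \det G * (2 * G 0 2); \det G * (G 0 0 + G 1 2);
    \det G * G 0 1; \det G * (4^-1 * G 1 1)]`_i.
  rewrite /f !coefE; case: i => [|[|[|[|[|i]]]]] /=; rewrite ?nth_nil; ring.
have [|s|c [k [szk fE]]] := @quartic_nonsquare_sqr _ n cardF f n_ge4.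
- apply/eqP; rewrite eqn_leq; apply/andP; split.
    by apply/leq_sizeP => -[|[|[|[|[|i]]]]] // _; rewrite cf /= nth_nil.
  rewrite ltnNge; apply/negP => /leq_sizeP/(_ 4 isT)/eqP; rewrite cf /=.
  by rewrite !mulf_eq0 (negPf D0) invr_eq0 (negPf four0) (negPf G11).
- have -> : f.[s] = bil G (pt s) (pt s) * \det G.
    by rewrite bil_pt // !(hornerZ, hornerD, hornerXn, hornerX, hornerC); ring.
  apply: (inscribed_nsq cardF n_even insG); last first.
    by rewrite -isotropic_pt_eq; apply/disj/isotropic_pt.
  have [_ _ _ inV _] := insP; apply: inV; exact: isotropic_pt.
have kE : k = k`_2 *: 'X^2 + k`_1 *: 'X + (k`_0)%:P.
  apply/polyP => i; rewrite !coefE; case: i => [|[|[|i]]] /=; try by ring.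
  by rewrite nth_default ?(leq_trans szk) //; ring.
have kk : k ^+ 2 = (k`_2 ^+ 2) *: 'X^4 + (2 * k`_1 * k`_2) *: 'X^3
  + (k`_1 ^+ 2 + 2 * k`_0 * k`_2) *: 'X^2 + (2 * k`_0 * k`_1) *: 'X + (k`_0 ^+ 2)%:P.
  rewrite {1}kE -!mul_polyC !(polyCD, polyCM, polyC_exp, polyC_natr).
  ring.
have ck i : f`_i = c * [:: k`_0 ^+ 2; 2 * k`_0 * k`_1; k`_1 ^+ 2 + 2 * k`_0 * k`_2;
    2 * k`_1 * k`_2; k`_2 ^+ 2]`_i.
  rewrite fE kk !coefE; case: i => [|[|[|[|[|i]]]]] /=; rewrite ?nth_nil; ring.
have cc i := etrans (esym (cf i)) (ck i).
have := cc 0%N; have := cc 1%N; have := cc 2%N; have := cc 3%N; have := cc 4%N.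
rewrite /= => e4 e3 e2 e1 e0.
have De : \det G * (c / \det G) = c by rewrite mulrC divfK.
exists (G 1 2 - (c / \det G) * (2 * k`_2 * k`_0)), (c / \det G), (row3 k`_1 (2 * k`_2) k`_0).
have := parabola_pencil (v := row3 k`_1 (2 * k`_2) k`_0) (e := c / \det G) symG.
rewrite !row3E; apply; apply: (mulfI D0); rewrite [RHS]mulrA De.
- by rewrite e2; ring.
- by apply: (mulfI (invr_neq0 four0)); rewrite mulrCA e4; field.
- by rewrite e0.
- by rewrite e3; ring.
- by apply: (mulfI two0); rewrite mulrCA e1; ring.
Qed.

(** Choose coordinates in which A' is the parabola, with a common point of the two
    conics at infinity if there is one. *)
Lemma inscribed_pencil V A A' : inscribed V A -> inscribed V A' ->
  exists (c e : F) v, c != 0 /\ A = c *: A' + e *: (v^T *m v).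
Proof.
move=> insA insA'; have [symA unitA _ _ _] := insA; have [symA' unitA' isoA' _ _] := insA'.
suff [c [e [v AE]]] : exists (c e : F) v, A = c *: A' + e *: (v^T *m v).
  exists c, e, v; split=> //; apply/eqP => c0.
  have := mxrank_unit unitA; rewrite AE c0 scale0r add0r scalemxAl => rk.
  by have := leq_trans (mxrankM_maxr (e *: v^T) v) (rank_leq_row v); rewrite rk.
have reduce r : isotropic A' r -> exists M d, [/\ M \in unitmx, d != 0, row 1 M = r,
    M *m A' *m M^T = d *: parabola F &
    inscribed [set x | x *m M \in V] (parabola F)].
  move=> isor; have [M [d [unitM d0 rM MA]]] := parabola_form two0 symA' unitA' isor.
  exists M, d; split=> //.
  have := inscribed_scale (invr_neq0 d0) (inscribed_mulmx unitM insA').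
  by rewrite MA scalerA mulVf // scale1r.
have back M d : M \in unitmx -> d != 0 -> M *m A' *m M^T = d *: parabola F ->
    (exists (c e : F) v, M *m A *m M^T = c *: parabola F + e *: (v^T *m v)) ->
    exists (c e : F) v, A = c *: A' + e *: (v^T *m v).
  move=> unitM d0 MA' [c [e [v MA]]]; exists (c / d), e, (v *m invmx M^T).
  have unitMT : M^T \in unitmx by rewrite unitmx_tr.
  apply: (can_inj (mulKmx unitM)); apply: (can_inj (mulmxK unitMT)).
  rewrite MA mulmxDr mulmxDl -!scalemxAr -!scalemxAl MA' scalerA divfK //.
  by rewrite trmx_mul trmx_inv trmxK !mulmxA mulmxV // mul1mx mulmxKV.
have [[r /andP[isor' isor]] | /existsPn disj] :=
    altP (@existsP _ (fun r => isotropic A' r && isotropic A r)).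
  have [M [d [unitM d0 rM MA' insP]]] := reduce r isor'.
  apply: (back M d) => //; apply: touching_parabola (inscribed_mulmx unitM insA) insP _.
  by rewrite isotropic_mulmx // mul_rV3 !row3E rM !scale0r scale1r add0r addr0.
have [r isor'] := isoA'; have [M [d [unitM d0 _ MA' insP]]] := reduce r isor'.
apply: (back M d) => //; apply: disjoint_parabola (inscribed_mulmx unitM insA) insP _.
move=> x isox; rewrite isotropic_mulmx //; have := disj (x *m M).
by rewrite -[isotropic A' _]isotropic_mulmx // MA' isotropic_scale // isox.
Qed.

End Pencils.

(** * Conics with a common self-polar triangle *)

Section Triangle.
Local Open Scope ring_scope.

Section RankOne.
Variable F : fieldType.
Implicit Types a b c d e k l x y : F.

(** The minors of order 2 of d y^T y vanish. Written in terms of x, this says that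
    x lies on a side of the triangle of reference or at the opposite vertex. *)
Lemma rank_one_diag_change e d x0 x1 x2 y0 y1 y2 l k a b c :
  e != 0 -> a != 0 -> b != 0 -> c != 0 -> (l != 0) || (k != 0) ->
  d * y0 ^+ 2 = e * x0 ^+ 2 + l * a -> d * y1 ^+ 2 = e * x1 ^+ 2 + k * b ->
  d * y2 ^+ 2 = e * x2 ^+ 2 + l * c ->
  d * (y0 * y1) = e * (x0 * x1) -> d * (y0 * y2) = e * (x0 * x2) ->
  d * (y1 * y2) = e * (x1 * x2) ->
  x1 = 0 \/ x0 = 0 /\ x2 = 0.
Proof.
move=> e0 a0 b0 c0 lk e00 e11 e22 e01 e02 e12.
have m1 : e * (k * b) * (x0 * x2) = 0.
  transitivity ((d * y1 ^+ 2) * (d * (y0 * y2)) - (d * (y0 * y1)) * (d * (y1 * y2))).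
    by rewrite e11 e02 e01 e12; ring.
  by ring.
have m0 : e * (l * a) * (x1 * x2) = 0.
  transitivity ((d * y0 ^+ 2) * (d * (y1 * y2)) - (d * (y0 * y1)) * (d * (y0 * y2))).
    by rewrite e00 e02 e01 e12; ring.
  by ring.
have m2 : e * (l * c) * (x0 * x1) = 0.
  transitivity ((d * y2 ^+ 2) * (d * (y0 * y1)) - (d * (y1 * y2)) * (d * (y0 * y2))).
    by rewrite e22 e02 e01 e12; ring.
  by ring.
have m01 : e * (x0 ^+ 2 * (k * b) + x1 ^+ 2 * (l * a)) + l * a * (k * b) = 0.
  transitivity ((d * y0 ^+ 2) * (d * y1 ^+ 2) - (d * (y0 * y1)) ^+ 2).
    by rewrite e00 e11 e01; ring.
  by ring.
have m12 : e * (x2 ^+ 2 * (k * b) + x1 ^+ 2 * (l * c)) + l * c * (k * b) = 0.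
  transitivity ((d * y2 ^+ 2) * (d * y1 ^+ 2) - (d * (y1 * y2)) ^+ 2).
    by rewrite e22 e11 e12; ring.
  by ring.
have m02 : e * (x0 ^+ 2 * (l * c) + x2 ^+ 2 * (l * a)) + l * a * (l * c) = 0.
  transitivity ((d * y0 ^+ 2) * (d * y2 ^+ 2) - (d * (y0 * y2)) ^+ 2).
    by rewrite e22 e00 e02; ring.
  by ring.
have [-> | x1n] := eqVneq x1 0; first by left.
right; move/eqP: m0; move/eqP: m2; rewrite !mulf_eq0 (negPf e0) (negPf a0) (negPf c0).
rewrite (negPf x1n) !orbF /=.
have [l0 _ _ | ln] := eqVneq l 0.
  move: lk m01 m12; rewrite l0 eqxx /= => k0.
  rewrite !mul0r !mulr0 !addr0 => /eqP + /eqP.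
  by rewrite !mulf_eq0 (negPf e0) (negPf k0) (negPf b0) !orbF /= !orbb => /eqP-> /eqP->.
by rewrite /= => /eqP-> /eqP->.
Qed.

(** The off-diagonal entries of e v^T v vanish, so this matrix has at most one
    nonzero entry. *)
Lemma diag3_rank_one a b c a' b' c' k e (v : 'rV[F]_3) :
  diag3 a' b' c' = k *: diag3 a b c + e *: (v^T *m v) ->
  [\/ a' = k * a /\ b' = k * b, a' = k * a /\ c' = k * c | b' = k * b /\ c' = k * c].
Proof.
move=> /matrixP D; have E i j := D i j.
have := E 0 0; have := E 1 1; have := E 2 2; have := E 0 1; have := E 0 2; have := E 1 2.
rewrite scale_diag3 ![(_ + _ : 'M_3) _ _]mxE ![(_ *: _ : 'M_3) _ _]mxE !tensorE !diag3E !add0r.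
have [-> | e0] := eqVneq e 0.
  by rewrite !mul0r !addr0 => _ _ _ c'E b'E a'E; constructor 1.
move=> /esym/eqP + /esym/eqP + /esym/eqP.
rewrite !mulf_eq0 (negPf e0) /=.
have simp := (mul0r, mulr0, addr0).
have [-> | v0] := eqVneq (v 0 0) 0; have [-> | v1] := eqVneq (v 0 1) 0;
  have [-> | v2] := eqVneq (v 0 2) 0; rewrite //= !simp => _ _ _ c'E b'E a'E.
- by constructor 1.
- by constructor 1.
- by constructor 2.
- by constructor 3.
Qed.

End RankOne.

Variables (F : finFieldType) (n q : nat).
Hypotheses (cardF : #|F| = (2 * n).+1) (n_even : ~~ odd n) (n_ge4 : (4 <= n)%N).
Hypotheses (cardFq : #|F| = (q ^ 2)%N) (q_ge3 : (3 <= q)%N) (two_sqr : nsq n (2 : F) = false).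
Implicit Types (V : {set 'rV[F]_3}) (A M : 'M[F]_3) (u v w r : 'rV[F]_3).
Let two0 : 2 != 0 :> F := two_neq0 cardF.

Lemma card_isotropic A : A^T = A -> A \in unitmx ->
  (#|[set r | isotropic A r]| <= #|F| ^ 2 - 1)%N.
Proof.
move=> symA unitA.
have [-> | [r0]] := set_0Vmem [set r | isotropic A r]; first by rewrite cards0.
rewrite inE => isor0.
have [M [d [unitM d0 _ MA]]] := parabola_form two0 symA unitA isor0.
(* On the parabola, the second coordinate is determined by the others if the
   third does not vanish; otherwise the first vanishes too. *)
pose key (x : 'rV[F]_3) : F * F := if x 0 2 == 0 then (x 0 1, 0) else (x 0 0, x 0 2).
pose P := [set x | isotropic (parabola F) x].
have -> : #|[set r | isotropic A r]| = #|P|.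
  rewrite -(card_imset P (can_inj (mulmxK unitM))); congr #|pred_of_set _|.
  apply/setP => r; rewrite inE; apply/idP/imsetP => [isor | [x]].
    exists (r *m invmx M); last by rewrite mulmxKV.
    by rewrite inE -[isotropic _ _](isotropic_scale _ _ d0) -MA isotropic_mulmx // mulmxKV.
  by rewrite inE => isox ->; rewrite -isotropic_mulmx // MA isotropic_scale.
have Peq x : x \in P -> 2 * x 0 1 * x 0 2 = x 0 0 ^+ 2.
  rewrite inE => /andP[_]; rewrite bil_parabola subr_eq0 -expr2 => /eqP <-; ring.
have P0 x : x \in P -> x != 0 by rewrite inE => /andP[].
have P2 x : x \in P -> x 0 2 = 0 -> x 0 0 = 0.
  by move=> xP x2; apply/eqP; rewrite -sqrf_eq0 -Peq // x2 mulr0.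
have keyI : {in P &, injective key}.
  move=> x y xP yP; rewrite /key.
  case: eqVneq => x2; case: eqVneq => y2 [].
  - by move=> e1; apply: row3P; rewrite ?x2 ?y2 ?(P2 x) ?(P2 y).
  - by move=> _ e; rewrite -e eqxx in y2.
  - by move=> _ e; rewrite e eqxx in x2.
  move=> e0 e2; apply: row3P => //; apply: (mulfI two0); apply: (mulIf x2).
  by rewrite Peq // e2 Peq // e0.
rewrite -(card_in_imset keyI).
have -> : (#|F| ^ 2 - 1)%N = #|[set~ (0, 0) : F * F]|.
  by rewrite cardsC1 card_prod mulnn subn1.
apply/subset_leq_card/subsetP => _ /imsetP[x xP ->]; rewrite in_setC1 /key.
have [x2 | x2] := eqVneq (x 0 2) 0; last by apply: contra_neq x2 => -[].
apply: contra_neq (P0 x xP) => -[x1].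
by apply: row3P; rewrite [RHS]mxE; rewrite ?x1 ?x2 ?(P2 x).
Qed.

(** Any two of the conics differ by a multiple of the square of a coordinate, up to
    a factor. The products of the conditions of [inscribed_nsq_diff] for the three
    pairs give the square classes. *)
Lemma triangle_classes V (a b c m : F) : m != 0 -> m != 1 ->
  inscribed V (diag3 a b c) -> inscribed V (diag3 a (b * m) c) ->
  inscribed V (diag3 a b (c / m)) ->
  [/\ nsq n (m - 1), nsq n m = false, nsq n (a * b) = false & nsq n (b * c) = false].
Proof.
move=> m0 m1 ins1 ins2 ins3.
have m10 : m - 1 != 0 by rewrite subr_eq0.
have [a0 b0 c0] : [/\ a != 0, b != 0 & c != 0].
  have [_ + _ _ _] := ins1; rewrite unitmxE unitfE det_diag3 !mulf_eq0 !negb_or.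
  by case/andP=> /andP[].
have change D D' e v : inscribed V D -> inscribed V D' -> e != 0 -> v != 0 ->
    D = 1 *: D' + e *: (v^T *m v) -> nsq n (e * \det D) /\ nsq n (e * \det D').
  move=> insD insD' e0 v0 DE.
  have := inscribed_nsq_diff cardF n_even insD insD' DE (oner_neq0 _) e0 v0.
  by rewrite mul1r.
have [N1 N2] : nsq n (b * (m - 1) * \det (diag3 a (b * m) c)) /\
    nsq n (b * (m - 1) * \det (diag3 a b c)).
  apply: change ins2 ins1 _ (_ : row3 0 1 0 != 0) _.
  - by rewrite mulf_neq0.
  - by rewrite row3_neq0 ?oner_neq0 ?orbT.
  - by rewrite -diag3_change; congr diag3; ring.
have [_ N3] : nsq n (c * (m^-1 - 1) * \det (diag3 a b (c / m))) /\
    nsq n (c * (m^-1 - 1) * \det (diag3 a b c)).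
  apply: change ins3 ins1 _ (_ : row3 0 0 1 != 0) _.
  - by rewrite mulf_neq0 // subr_eq0 invr_eq1.
  - by rewrite row3_neq0 ?oner_neq0 ?orbT.
  - by rewrite -diag3_change; congr diag3; ring.
have [_ N4] : nsq n (a * (m - 1) * \det (diag3 (a * m) (b * m) c)) /\
    nsq n (a * (m - 1) * \det (diag3 a (b * m) c)).
  have ins3' : inscribed V (diag3 (a * m) (b * m) c).
    have := inscribed_scale m0 ins3.
    by rewrite scale_diag3 ![m * _]mulrC divfK.
  apply: change ins3' ins2 _ (_ : row3 1 0 0 != 0) _.
  - by rewrite mulf_neq0.
  - by rewrite row3_neq0 ?oner_neq0 ?orbT.
  - by rewrite -diag3_change; congr diag3; ring.
rewrite !det_diag3 in N1 N2 N3 N4.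
have abc0 : a * b * c != 0 by rewrite !mulf_neq0.
have sqrm : nsq n m = false.
  rewrite -(nsqM cardF N1 N2) -[LHS](nsq_sqrM cardF _ (_ : b * (m - 1) * (a * b * c) != 0)).
    by congr (nsq n _); ring.
  by rewrite !mulf_neq0.
have [s ms] := not_nsq_sqr cardF (negbT sqrm).
have s0 : s != 0 by apply: contra_neq m0 => s0; rewrite ms s0 expr2 mulr0.
have sqrbc : nsq n (b * c) = false.
  rewrite -(nsqM cardF N2 N3) -nsqN //.
  rewrite -[LHS](nsq_sqrM cardF _ (_ : (m - 1) * (a * b * c) / s != 0)).
    by congr (nsq n _); rewrite ms; field.
  by rewrite !mulf_neq0 ?invr_neq0.
have sqrab : nsq n (a * b) = false.
  rewrite -(nsqM cardF N4 N2).
  rewrite -[LHS](nsq_sqrM cardF _ (_ : (m - 1) * (a * b * c) * s != 0)).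
    by congr (nsq n _); rewrite ms; ring.
  by rewrite !mulf_neq0.
split=> //.
have [t abt] := not_nsq_sqr cardF (negbT sqrab).
have [u bcu] := not_nsq_sqr cardF (negbT sqrbc).
have tu0 : t * u != 0.
  by rewrite -sqrf_eq0 exprMn -abt -bcu !mulf_neq0.
rewrite -(nsq_sqrM cardF _ tu0) exprMn -abt -bcu.
by rewrite (_ : _ * _ = b * (m - 1) * (a * b * c)) //; ring.
Qed.

(** The pencils that a fourth conic spans with the three given ones force it to be
    diagonal, and to differ from a multiple of the first one in a single entry.
    Comparing it with the second and the third leaves only the possibility
    m^2 = 1. But m = -1 is excluded because m - 1 = -2 is a square. *)
Lemma triangle_no_fourth V A (a b c m : F) : m != 0 -> m != 1 ->
  inscribed V (diag3 a b c) -> inscribed V (diag3 a (b * m) c) ->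
  inscribed V (diag3 a b (c / m)) -> inscribed V A ->
  exists k, [\/ A = k *: diag3 a b c, A = k *: diag3 a (b * m) c
            | A = k *: diag3 a b (c / m)].
Proof.
move=> m0 m1 ins1 ins2 ins3 insA.
have [nsqm1 _ _ _] := triangle_classes m0 m1 ins1 ins2 ins3.
have mm1 : m * m != 1.
  apply: contraTneq nsqm1 => /eqP; rewrite -subr_eq0.
  rewrite (_ : _ - _ = (m - 1) * (m + 1)); last by ring.
  rewrite mulf_eq0 subr_eq0 (negPf m1) addr_eq0 /= => /eqP->.
  by rewrite -opprD nsqN // two_sqr.
have [a0 b0 c0] : [/\ a != 0, b != 0 & c != 0].
  have [_ + _ _ _] := ins1; rewrite unitmxE unitfE det_diag3 !mulf_eq0 !negb_or.
  by case/andP=> /andP[].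
have [k1 [e1 [x [k10 AE1]]]] := inscribed_pencil cardF n_even n_ge4 insA ins1.
have [k2 [e2 [y [k20 AE2]]]] := inscribed_pencil cardF n_even n_ge4 insA ins2.
have [k3 [e3 [z [k30 AE3]]]] := inscribed_pencil cardF n_even n_ge4 insA ins3.
have [e10 | e10] := eqVneq e1 0.
  by exists k1; constructor 1; rewrite AE1 e10 scale0r addr0.
have entry (k : F) (D : 'M_3) e (v : 'rV_3) i j :
    (k *: D + e *: (v^T *m v)) i j = k * D i j + e * (v 0 i * v 0 j).
  by rewrite !mxE big_ord1 !mxE.
have E2 i j := etrans (esym (entry k2 (diag3 a (b * m) c) e2 y i j))
  (etrans (congr1 (fun B : 'M_3 => B i j) (etrans (esym AE2) AE1))
    (entry k1 (diag3 a b c) e1 x i j)).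
have E3 i j := etrans (esym (entry k3 (diag3 a b (c / m)) e3 z i j))
  (etrans (congr1 (fun B : 'M_3 => B i j) (etrans (esym AE3) AE1))
    (entry k1 (diag3 a b c) e1 x i j)).
have x1x02 : x 0 1 = 0 \/ x 0 0 = 0 /\ x 0 2 = 0.
  apply: (@rank_one_diag_change _ e1 e2 _ _ _ (y 0 0) (y 0 1) (y 0 2)
    (k1 - k2) (k1 - k2 * m) a b c) => //.
  - have [/eqP|//] := eqVneq (k1 - k2) 0; rewrite subr_eq0 => /eqP ->.
    by rewrite -[X in X - _]mulr1 -mulrBr mulf_neq0 // subr_eq0 eq_sym.
  - apply: (addrI (k2 * a)). have := E2 0 0; rewrite !diag3E -!expr2 => ->; ring.
  - apply: (addrI (k2 * (b * m))). have := E2 1 1; rewrite !diag3E -!expr2 => ->; ring.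
  - apply: (addrI (k2 * c)). have := E2 2 2; rewrite !diag3E -!expr2 => ->; ring.
  - by have := E2 0 1; rewrite !diag3E !mulr0 !add0r.
  - by have := E2 0 2; rewrite !diag3E !mulr0 !add0r.
  - by have := E2 1 2; rewrite !diag3E !mulr0 !add0r.
have x2x01 : x 0 2 = 0 \/ x 0 0 = 0 /\ x 0 1 = 0.
  apply: (@rank_one_diag_change _ e1 e3 _ _ _ (z 0 0) (z 0 2) (z 0 1)
    (k1 - k3) (k1 - k3 / m) a c b) => //.
  - have [/eqP|//] := eqVneq (k1 - k3) 0; rewrite subr_eq0 => /eqP ->.
    by rewrite -[X in X - _]mulr1 -mulrBr mulf_neq0 // subr_eq0 eq_sym invr_eq1.
  - apply: (addrI (k3 * a)). have := E3 0 0; rewrite !diag3E -!expr2 => ->; ring.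
  - apply: (addrI (k3 * (c / m))). have := E3 2 2; rewrite !diag3E -!expr2 => ->; ring.
  - apply: (addrI (k3 * b)). have := E3 1 1; rewrite !diag3E -!expr2 => ->; ring.
  - by have := E3 0 2; rewrite !diag3E !mulr0 !add0r.
  - by have := E3 0 1; rewrite !diag3E !mulr0 !add0r.
  - by have := E3 2 1; rewrite !diag3E !mulr0 !add0r.
have diagA : x 0 0 * x 0 1 = 0 -> x 0 0 * x 0 2 = 0 -> x 0 1 * x 0 2 = 0 ->
    A = diag3 (k1 * a + e1 * x 0 0 ^+ 2) (k1 * b + e1 * x 0 1 ^+ 2) (k1 * c + e1 * x 0 2 ^+ 2).
  move=> x01 x02 x12; rewrite AE1; apply/matrixP; apply: ord3_ind; apply: ord3_ind;
    rewrite entry !diag3E -?expr2 ?x01 ?x02 ?x12 ?[x 0 1 * x 0 0]mulrC ?[x 0 2 * _]mulrC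
      ?x01 ?x02 ?x12 ?mulr0 ?addr0 //.
have A01 : x 0 0 = 0 -> x 0 1 = 0 -> exists k, [\/ A = k *: diag3 a b c,
    A = k *: diag3 a (b * m) c | A = k *: diag3 a b (c / m)].
  move=> x0 x1; have /= := diagA; rewrite x0 x1 !mul0r expr0n !mulr0 !addr0.
  move=> /(_ erefl erefl erefl); set c' := _ + _ => AE.
  have := AE2; rewrite AE => /diag3_rank_one[] [e f].
  - have k12 := mulIf a0 e; move: f; rewrite -k12 => /(mulfI k10) /eqP.
    by rewrite -[X in X == _]mulr1 (inj_eq (mulfI b0)) eq_sym (negPf m1).
  - by have k12 := mulIf a0 e; exists k1; constructor 1; rewrite scale_diag3 f k12.
  - have k12 : k1 = k2 * m by apply: (mulIf b0); rewrite e; ring.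
    exists k1; constructor 3; rewrite scale_diag3 f k12; congr diag3; by field.
have A02 : x 0 0 = 0 -> x 0 2 = 0 -> exists k, [\/ A = k *: diag3 a b c,
    A = k *: diag3 a (b * m) c | A = k *: diag3 a b (c / m)].
  move=> x0 x2; have /= := diagA; rewrite x0 x2 !mul0r !mulr0 expr0n !mulr0 !addr0.
  move=> /(_ erefl erefl erefl); set b' := _ + _ => AE.
  have := AE3; rewrite AE => /diag3_rank_one[] [e f].
  - by have k13 := mulIf a0 e; exists k1; constructor 1; rewrite scale_diag3 f k13.
  - have k13 := mulIf a0 e; move: f; rewrite -k13 => /(mulfI k10) /eqP.
    by rewrite -[X in X == _]mulr1 (inj_eq (mulfI c0)) eq_sym invr_eq1 (negPf m1).
  - have k13 : k3 = k1 * m by apply: (mulIf c0); rewrite mulrAC f; field.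
    exists k1; constructor 2; rewrite scale_diag3 e k13; congr diag3; by ring.
have A12 : x 0 1 = 0 -> x 0 2 = 0 -> exists k, [\/ A = k *: diag3 a b c,
    A = k *: diag3 a (b * m) c | A = k *: diag3 a b (c / m)].
  move=> x1 x2; have /= := diagA; rewrite x1 x2 !mulr0 expr0n !mulr0 !addr0.
  move=> /(_ erefl erefl erefl); set a' := _ + _ => AE.
  have := AE2; rewrite AE => /diag3_rank_one[] [e f].
  - have k12 : k1 = k2 * m by apply: (mulIf b0); rewrite f; ring.
    have := AE3; rewrite AE => /diag3_rank_one[] [e' f'].
    + have k13 := mulIf b0 f'; exists k1; constructor 1; rewrite scale_diag3.
      by rewrite e' k13.
    + have k13 : k3 = k1 * m by apply: (mulIf c0); rewrite mulrAC f'; field.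
      move: e'; rewrite e k13 k12 => /(mulIf a0) /eqP.
      rewrite -[X in X == _]mulr1 -!mulrA (inj_eq (mulfI k20)) eq_sym.
      by rewrite (negPf mm1).
    + have k13 := mulIf b0 e'; move: f'; rewrite -k13 => /(mulfI k10) /eqP.
      by rewrite -[X in X == _]mulr1 (inj_eq (mulfI c0)) eq_sym invr_eq1 (negPf m1).
  - by have k12 := mulIf c0 f; exists k1; constructor 1; rewrite scale_diag3 e k12.
  - have k12 := mulIf c0 f; move: e; rewrite -k12 => /(mulfI k10) /eqP.
    by rewrite -[X in X == _]mulr1 (inj_eq (mulfI b0)) eq_sym (negPf m1).
case: x1x02 => [x1 | [x0 x2]]; last exact: A02.
by case: x2x01 => [x2 | [x0 _]]; [apply: A12 | apply: A01].
Qed.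

(** For q > 3 the three conics have less than q^3 + 1 points because each has
    q^2 + 1. For q = 3 it also matters that two points of the third conic are on
    the first, and that the first two have a common point. *)
Lemma triangle_absurd V (a b c m : F) : m != 0 -> m != 1 ->
  inscribed V (diag3 a b c) -> inscribed V (diag3 a (b * m) c) ->
  inscribed V (diag3 a b (c / m)) -> covered V ->
  #|V| <> (#|F|.-1 * (q ^ 3 + 1))%N.
Proof.
move=> m0 m1 ins1 ins2 ins3 coverV cardV.
have [_ _ sqrab sqrbc] := triangle_classes m0 m1 ins1 ins2 ins3.
have [a0 b0 c0] : [/\ a != 0, b != 0 & c != 0].
  have [_ + _ _ _] := ins1; rewrite unitmxE unitfE det_diag3 !mulf_eq0 !negb_or.
  by case/andP=> /andP[].
set C1 := [set r | isotropic (diag3 a b c) r].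
set C2 := [set r | isotropic (diag3 a (b * m) c) r].
set C3 := [set r | isotropic (diag3 a b (c / m)) r].
have VC : V \subset C1 :|: C2 :|: C3.
  apply/subsetP => v /coverV[A [insA isov]]; rewrite !inE.
  have [k AE] := triangle_no_fourth m0 m1 ins1 ins2 ins3 insA.
  have [_ unitA _ _ _] := insA.
  have k0 : k != 0.
    apply/eqP => k0; move: unitA; rewrite unitmxE unitfE.
    by case: AE => ->; rewrite k0 scale0r det0 eqxx.
  by case: AE isov => ->; rewrite isotropic_scale // => ->; rewrite ?orbT.
have bilD (a' b' c' : F) u : bil (diag3 a' b' c') u u =
    a' * u 0 0 ^+ 2 + b' * u 0 1 ^+ 2 + c' * u 0 2 ^+ 2.
  by rewrite bilE !diag3E; ring.
have [i iE] := sqrt_m1 cardF n_even.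
have [s1 s1E] := not_nsq_sqr cardF (negbT sqrab).
have [s2 s2E] := not_nsq_sqr cardF (negbT sqrbc).
pose t := i * s1 / b; pose s := i * s1 * s2 / (b * c).
have tE : b * t ^+ 2 = - a.
  have -> : b * t ^+ 2 = i ^+ 2 * s1 ^+ 2 / b by rewrite /t; field.
  by rewrite iE -s1E; field.
have sE : c * s ^+ 2 = - a.
  have -> : c * s ^+ 2 = i ^+ 2 * s1 ^+ 2 * s2 ^+ 2 / (b ^+ 2 * c).
    by rewrite /s; field; rewrite b0 c0.
  by rewrite iE -s1E -s2E; field; rewrite b0 c0.
clearbody t s; pose u := row3 1 0 s; pose v := row3 1 t 0; pose w := row3 1 (- t) 0.
have nz (x y : F) : row3 1 x y != 0 by rewrite row3_neq0 ?oner_neq0.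
have uC : scalings u \subset C1 :&: C2.
  rewrite subsetI !scalings_isotropic // /isotropic nz bilD !row3E ?sE; apply/eqP; ring: sE.
have vwC : scalings v :|: scalings w \subset (C1 :|: C2) :&: C3.
  have sqC1 x : x ^+ 2 = t ^+ 2 -> scalings (row3 1 x 0) \subset C1 :&: C3.
    move=> xt; rewrite subsetI !scalings_isotropic // /isotropic nz bilD !row3E xt tE;
      by apply/eqP; ring.
  by apply: subset_trans (setSI C3 (subsetUl C1 C2)); rewrite subUset !sqC1 // sqrrN.
have t0 : t != 0.
  by apply: contra_neq a0 => t0; apply: oppr_inj; rewrite -tE t0 expr2 !mulr0 oppr0.
have vw : #|scalings v :|: scalings w| = (#|F|.-1 + #|F|.-1)%N.
  suff dvw : scalings v :&: scalings w = set0.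
    by rewrite cardsU dvw cards0 subn0 /v /w !card_scalings ?nz.
  apply/eqP; rewrite -subset0; apply/subsetP => x; rewrite inE => /andP[].
  case/imsetP => k; rewrite in_setC1 => k0 -> /imsetP[l _ /rowP e].
  have := e 0; have := e 1; rewrite !mxE /= => e1 e0.
  have kl : k = l by rewrite -[k]mulr1 e0 mulr1.
  move: e1; rewrite kl => /eqP; rewrite mulrN -addr_eq0 -mulr2n -mulr_natl.
  by rewrite !mulf_eq0 (negPf two0) (negPf t0) -kl (negPf k0).
have := subset_leq_card VC; rewrite cardV cardsU.
have := subset_leq_card uC; have := subset_leq_card vwC.
rewrite vw (cardsU C1 C2) /u card_scalings ?nz //.
have cardC D : inscribed V D -> (#|[set r | isotropic D r]| <= #|F| ^ 2 - 1)%N.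
  by move=> [symD unitD _ _ _]; apply: card_isotropic.
have := cardC _ ins1; have := cardC _ ins2; have := cardC _ ins3.
rewrite -/C1 -/C2 -/C3.
move: #|C1| #|C2| #|C3| #|_ :&: C3| #|C1 :&: C2| => c1 c2 c3 c12 c13.
have F0 : #|F| = #|F|.-1.+1 by rewrite cardF.
have dq : (q ^ 2)%N = #|F|.-1.+1 by rewrite -cardFq.
have d0 : (0 < #|F|.-1)%N by rewrite cardF /=; clear -n_ge4; lia.
rewrite [X in (X ^ 2)%N]F0; move: #|F|.-1 dq d0 => d dq d0.
move=> h3 h2 h1 k2 k1 k0.
have : (d * (q ^ 3 + 1) <= d * (3 * d.+1))%N by clear -h3 h2 h1 k2 k1 k0; nia.
rewrite leq_pmul2l // -dq expnS.
have : (3 * q ^ 2 <= q * q ^ 2)%N by rewrite leq_pmul2r ?expn_gt0; clear -q_ge3; lia.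
by clear; lia.
Qed.

End Triangle.

(** * The common double line *)

Section CommonPencil.
Local Open Scope ring_scope.
Variables (F : finFieldType) (n q : nat).
Hypotheses (cardF : #|F| = (2 * n).+1) (n_even : ~~ odd n) (n_ge4 : (4 <= n)%N).
Hypotheses (cardFq : #|F| = (q ^ 2)%N) (q_ge3 : (3 <= q)%N) (two_sqr : nsq n (2 : F) = false).
Implicit Types (V : {set 'rV[F]_3}) (A M : 'M[F]_3) (u v w r : 'rV[F]_3).

(** The second and third conics also span a pencil with a double line v1. If their
    difference is a multiple of its square, the squares of v1, v2, v3 are linearly
    dependent, which is impossible as v2 and v3 are independent.
    Otherwise A is a linear combination of the three squares, so that the lines
    v1, v2, v3 form a self-polar triangle. *)
Lemma triangle_general_absurd V A (e2 e3 : F) v2 v3 :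
  e2 != 0 -> e3 != 0 -> v2 != 0 -> (forall k, v3 != k *: v2) ->
  inscribed V A -> inscribed V (A + e2 *: (v2^T *m v2)) ->
  inscribed V (A + e3 *: (v3^T *m v3)) -> covered V ->
  #|V| <> (#|F|.-1 * (q ^ 3 + 1))%N.
Proof.
move=> e20 e30 v20 v32 ins1 ins2 ins3 coverV.
have [k [e1 [v1 [k0 AE]]]] := inscribed_pencil cardF n_even n_ge4 ins3 ins2.
have dot u v w : bil (v^T *m v) u w = (u *m v^T) 0 0 * (w *m v^T) 0 0 by apply: bil_tensor.
have [k1 | k1] := eqVneq k 1.
  have [u [uv2 uv3]] := separating_vector v32.
  have [w [wv3 wv2]] : exists w : 'rV_3, (w *m v3^T) 0 0 = 0 /\ (w *m v2^T) 0 0 != 0.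
    apply: separating_vector => l; apply/eqP => v23.
    have l0 : l != 0 by apply: contra_neq v20 => l0; rewrite v23 l0 scale0r.
    by have /eqP[] := v32 l^-1; rewrite v23 scalerA mulVf // scale1r.
  have bE (x y : 'rV_3) : e3 * ((x *m v3^T) 0 0 * (y *m v3^T) 0 0) =
      e2 * ((x *m v2^T) 0 0 * (y *m v2^T) 0 0) + e1 * ((x *m v1^T) 0 0 * (y *m v1^T) 0 0).
    have := congr1 (fun B => bil B x y) AE; rewrite /= k1 scale1r.
    by rewrite !bil_add !bil_scale !dot -addrA => /addrI.
  have uu := bE u u; have uw := bE u w; have ww := bE w w.
  move: uu uw ww; rewrite uv2 wv3 !(mul0r, mulr0) !add0r => uu /esym/eqP uw /esym/eqP.
  move: uw; rewrite !mulf_eq0 => /or3P[/eqP e10|/eqP uv1|/eqP wv1].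
  - by move/eqP: uu; rewrite e10 mul0r !mulf_eq0 (negPf e30) (negPf uv3).
  - by move/eqP: uu; rewrite uv1 !mulr0 !mulf_eq0 (negPf e30) (negPf uv3).
  - by rewrite wv1 !mulr0 addr0 !mulf_eq0 (negPf e20) (negPf wv2).
have k10 : 1 - k != 0 by rewrite subr_eq0 eq_sym.
pose a := e1 / (1 - k); pose b := k * e2 / (1 - k); pose c := - e3 / (1 - k).
pose L := mx3 v1 v2 v3.
have AL : A = L^T *m diag3 a b c *m L.
  rewrite tensor_sum; apply/matrixP => i j.
  have /(congr1 (fun B : 'M_3 => B i j)) := AE.
  rewrite !mxE !big_ord1 !mxE => /eqP; rewrite -subr_eq0 => /eqP e.
  rewrite /a /b /c; apply: (mulfI k10); apply/eqP; rewrite -subr_eq0 -e.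
  by apply/eqP; field.
have A2L : A + e2 *: (v2^T *m v2) = L^T *m diag3 a (b * k^-1) c *m L.
  rewrite AL !tensor_sum /b; apply/matrixP => i j; rewrite !mxE !big_ord1 !mxE.
  by field; rewrite k10 k0.
have A3L : A + e3 *: (v3^T *m v3) = L^T *m diag3 a b (c / k^-1) *m L.
  rewrite AL !tensor_sum invrK /c; apply/matrixP => i j; rewrite !mxE !big_ord1 !mxE.
  by field.
have unitL : L \in unitmx.
  by have [_ + _ _ _] := ins1; rewrite AL !unitmx_mul => /andP[].
pose M := invmx L^T.
have unitM : M \in unitmx by rewrite unitmx_inv unitmx_tr.
have ML D : M *m (L^T *m D *m L) *m M^T = D.
  rewrite /M trmx_inv trmxK !mulmxA mulmxK // -mulmxA mulKmx ?unitmx_tr //.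
have ins1' := inscribed_mulmx unitM ins1; rewrite AL ML in ins1'.
have ins2' := inscribed_mulmx unitM ins2; rewrite A2L ML in ins2'.
have ins3' := inscribed_mulmx unitM ins3; rewrite A3L ML in ins3'.
rewrite -(card_mulmx _ unitM).
apply: (triangle_absurd cardF n_even n_ge4 cardFq q_ge3 two_sqr _ _ ins1' ins2' ins3').
- by rewrite invr_neq0.
- by rewrite invr_eq1.
- exact: covered_mulmx.
Qed.

(** A single conic has too few points to fill V, so there is a second one; the
    pencil of these two contains all others by [triangle_general_absurd]. *)
Lemma common_pencil V A : inscribed V A -> covered V ->
  #|V| = (#|F|.-1 * (q ^ 3 + 1))%N ->
  exists v, v != 0 /\ forall B, inscribed V B ->
    exists (c e : F), c != 0 /\ B = c *: A + e *: (v^T *m v).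
Proof.
move=> insA coverV cardV; have [symA unitA _ _ _] := insA.
have /subsetPn[w wV] : ~~ (V \subset [set r | isotropic A r]).
  apply/negP => /subset_leq_card; rewrite leqNgt => /negP[].
  apply: leq_ltn_trans (card_isotropic cardF symA unitA) _; rewrite cardV cardFq.
  have -> : ((q ^ 2) ^ 2 - 1 = (q ^ 2).-1 * (q ^ 2 + 1))%N by rewrite -subn1 -subn_sqr.
  have q_gt1 : (1 < q)%N by clear -q_ge3; lia.
  rewrite ltn_pmul2l ?ltn_add2r ?ltn_exp2l //.
  by rewrite -subn1 subn_gt0 (@ltn_exp2l _ 0 2).
rewrite inE => isow; have [A2 [insA2 isow2]] := coverV w wV.
have [k2 [e2 [v2 [k20 AE2]]]] := inscribed_pencil cardF n_even n_ge4 insA2 insA.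
have ev2 : e2 *: (v2^T *m v2) != 0.
  apply: contra isow => /eqP e; move: isow2.
  by rewrite AE2 e addr0 isotropic_scale.
have [e20 v20] : e2 != 0 /\ v2 != 0.
  by split; apply: contra_neq ev2 => ->; rewrite ?scale0r ?trmx0 ?mul0mx ?scaler0.
exists v2; split=> // B insB.
have [k3 [e3 [v3 [k30 AE3]]]] := inscribed_pencil cardF n_even n_ge4 insB insA.
have [e30 | e30] := eqVneq e3 0.
  by exists k3, 0; rewrite AE3 e30 !scale0r.
have [/existsP[k /eqP v3E] | /existsPn v32] := boolP [exists k, v3 == k *: v2].
  exists k3, (e3 * k ^+ 2); split=> //.
  by rewrite AE3 v3E; apply/matrixP => i j; rewrite !mxE !big_ord1 !mxE; ring.
have insA2' := inscribed_scale (invr_neq0 k20) insA2.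
have insB' := inscribed_scale (invr_neq0 k30) insB.
rewrite AE2 scalerDr !scalerA mulVf // scale1r in insA2'.
rewrite AE3 scalerDr !scalerA mulVf // scale1r in insB'.
have [] := triangle_general_absurd _ _ v20 v32 insA insA2' insB' coverV cardV.
all: by rewrite mulf_neq0 ?invr_neq0.
Qed.

End CommonPencil.

(** * The conics of a unital in odd characteristic *)

Section OddOrder.
Local Open Scope ring_scope.
Variables (F : finFieldType) (q m : nat).
Hypotheses (cardFq : #|F| = (q ^ 2)%N) (qE : q = (2 * m).+1) (m_gt0 : (0 < m)%N).
Hypothesis frobD : forall x y : F, (x + y) ^+ q = x ^+ q + y ^+ q.
Implicit Types (V : {set 'rV[F]_3}) (A M : 'M[F]_3) (u v w r p : 'rV[F]_3).

Let n := (2 * m * m.+1)%N.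
Let cardF : #|F| = (2 * n).+1. Proof. by rewrite cardFq qE /n; lia. Qed.
Let n_even : ~~ odd n. Proof. by rewrite /n -mulnA oddM. Qed.
Let n_ge4 : (4 <= n)%N. Proof. by rewrite /n; nia. Qed.
Let q_ge3 : (3 <= q)%N. Proof. by rewrite qE; lia. Qed.
Let two0 : 2 != 0 :> F := two_neq0 cardF.

Lemma two_sqr : nsq n (2 : F) = false.
Proof.
have two_q : 2 ^+ q = 2 :> F by rewrite frobD expr1n.
have two_q1 : 2 ^+ (2 * m) = 1 :> F by apply: (mulfI two0); rewrite -exprS -qE mulr1.
rewrite /nsq /n exprM two_q1 expr1n -addr_eq0; exact: negPf.
Qed.

(** If three collinear points are on the conic, any two of them are conjugate, so
    that one is a point of V on the tangent at the other. Hence the line has at most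
    two points of V, fewer than q + 1, and it has one. *)
Lemma pencil_line_scalings V A v :
  0 \notin V -> inscribed V A -> v != 0 ->
  (forall x, x \in line_vectors V v -> isotropic A x) ->
  #|line_vectors V v| = #|F|.-1 \/ #|line_vectors V v| = (#|F|.-1 * (q + 1))%N ->
  exists2 p, isotropic A p & line_vectors V v = scalings p.
Proof.
move=> V0 [symA unitA _ inV tgV] v0 isoL cardL.
have F1 : (0 < #|F|.-1)%N by rewrite cardF /=; clear -n_ge4; lia.
have [p pL] : exists p, p \in line_vectors V v.
  by apply/card_gt0P; case: cardL => ->; rewrite ?muln_gt0 ?F1 ?addn1.
have isop := isoL p pL; exists p => //.
have scL x : x \in line_vectors V v -> scalings x \subset line_vectors V v.
  move=> xL; apply/subsetP => y yx.
  have /subsetP/(_ _ yx) := scalings_isotropic (isoL x xL); rewrite inE => isoy.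
  rewrite inE inV //=; case/imsetP: yx => k _ ->.
  by move: xL; rewrite inE => /andP[_ /eqP xv]; rewrite -scalemxAl xv scaler0.
have p0 : p != 0 by case/andP: isop.
have cp := card_scalings p0.
case: cardL => cardL; first by apply/esym/eqP; rewrite eqEcard scL //= cp cardL leqnn.
have [r rL rp] : exists2 r, r \in line_vectors V v & r \notin scalings p.
  apply/subsetPn/negP => /subset_leq_card; rewrite cp cardL -[X in (_ <= X)%N]muln1.
  by rewrite leq_pmul2l //; clear -q_ge3; lia.
have isor := isoL r rL; have r0 : r != 0 by case/andP: isor.
have [w wL wpr] : exists2 w, w \in line_vectors V v & w \notin scalings p :|: scalings r.
  apply/subsetPn/negP => /subset_leq_card; rewrite cardL => le1.
  have := leq_trans le1 (leq_card_setU _ _); rewrite cp card_scalings // addnn -muln2.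
  by rewrite leq_pmul2l //; clear -q_ge3; lia.
have isow := isoL w wL.
have [rV pV wV] : [/\ r \in V, p \in V & w \in V].
  by move: rL pL wL; rewrite !inE => /andP[-> _] /andP[-> _] /andP[-> _].
have nsc x y : isotropic A y -> y \notin scalings x -> forall k, y <> k *: x.
  move=> /andP[y0 _] yx k yk; case/negP: yx; rewrite yk; apply/imsetP; exists k => //.
  by rewrite in_setC1; apply: contra_neq y0 => k0; rewrite yk k0 scale0r.
have pr : bil A p r != 0.
  by apply/eqP => pr; have [k] := tgV _ _ isop rV pr; apply: nsc.
have [x x0 xM] : exists2 x : 'rV_3, x != 0 & x *m mx3 p r w = 0.
  have : kermx (mx3 p r w) != 0.
    rewrite kermx_eq0 row_free_unit; apply/negP => unitM.
    case/eqP: v0; rewrite -[v]trmxK; apply/(canLR trmxK).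
    rewrite trmx0 -(mulKmx unitM v^T); apply/eqP.
    suff -> : mx3 p r w *m v^T = 0 by rewrite mulmx0.
    apply/row_matrixP; apply: ord3_ind; rewrite row_mul row_mx3 row0.
    - by move: pL; rewrite inE => /andP[_ /eqP].
    - by move: rL; rewrite inE => /andP[_ /eqP].
    - by move: wL; rewrite inE => /andP[_ /eqP].
  by case/rowV0Pn => x /sub_kermxP; exists x.
move: xM; rewrite mul_rV3 !row_mx3 => xM.
have [x2 | x2] := eqVneq (x 0 2) 0.
  move: xM; rewrite x2 scale0r addr0 => xM.
  have [x1 | x1] := eqVneq (x 0 1) 0.
    move/eqP: xM; rewrite x1 scale0r addr0 scaler_eq0 (negPf p0) orbF => /eqP x00.
    by case/eqP: x0; apply: row3P; rewrite [RHS]mxE.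
  case: (nsc _ _ isor rp (- x 0 0 / x 0 1)).
  apply: (scalerI x1); rewrite scalerA mulrC divfK // scaleNr.
  by apply/eqP; rewrite -addr_eq0 addrC xM.
have wE : w = (- x 0 0 / x 0 2) *: p + (- x 0 1 / x 0 2) *: r.
  apply: (scalerI x2); rewrite scalerDr !scalerA ![x 0 2 * _]mulrC !divfK // !scaleNr.
  by apply/eqP; rewrite -opprD -addr_eq0 addrC xM.
move: (- x 0 0 / x 0 2) (- x 0 1 / x 0 2) wE => a b wE.
case/andP: (isow) => _; rewrite {1 2}wE !bilDl !bilDr !bilZl !bilZr (bilC r) //.
case/andP: (isop) => _ /eqP->; case/andP: (isor) => _ /eqP->.
rewrite !mulr0 add0r addr0 mulrCA -mulr2n -mulr_natl !mulf_eq0 (negPf two0) (negPf pr) /=.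
move: wpr; rewrite inE negb_or => /andP[wp wr].
rewrite orbF => /orP[/eqP b0 | /eqP a0].
  by case: (nsc _ _ isow wp a); rewrite wE b0 scale0r addr0.
by case: (nsc _ _ isow wr b); rewrite wE a0 scale0r add0r.
Qed.

Lemma tangent_of_scalings V A v p :
  inscribed V A -> isotropic A p -> line_vectors V v = scalings p ->
  exists2 k, k != 0 & p *m A = k *: v.
Proof.
move=> [symA unitA _ inV _] isop Lp; case/andP: (isop) => p0 _.
have [k] := quadratic_tangent inV isop Lp.
rewrite /polar symA mulmxDr -mulr2n -scaler_nat => pA.
have pAk : p *m A = (k / 2) *: v.
  by apply: (scalerI two0); rewrite pA scalerA mulrC divfK.
exists (k / 2) => //; apply: contra_neq p0 => k0.
by rewrite -(mulmxK unitA p) pAk k0 scale0r mul0mx.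
Qed.

(** The conics 2yz - x^2 + a z^2 = 0. *)
Definition parabola_shift (a : F) : 'M[F]_3 :=
  parabola F + a *: ((row3 0 0 1)^T *m row3 0 0 1).

Lemma bil_parabola_shift a x :
  bil (parabola_shift a) x x = 2 * x 0 1 * x 0 2 - x 0 0 ^+ 2 + a * x 0 2 ^+ 2.
Proof.
rewrite bil_add bil_scale bil_tensor bil_parabola !mxE !sum_ord3 !mxE /=; ring.
Qed.

Lemma det_parabola_shift a : \det (parabola_shift a) = 1.
Proof.
rewrite (expand_det_row _ 0) sum_ord3 /cofactor.
rewrite !(expand_det_row _ 0) !big_ord_recl !big_ord0 /cofactor !det_mx11.
by rewrite !mxE !big_ord1 !mxE /=; ring.
Qed.

Lemma isotropic_parabola_shift a x : isotropic (parabola_shift a) x =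
  (x != 0) && (2 * x 0 1 * x 0 2 - x 0 0 ^+ 2 + a * x 0 2 ^+ 2 == 0).
Proof. by rewrite /isotropic bil_parabola_shift. Qed.

(** The conics are disjoint off the line z = 0, and that of a is recognized by its
    point (0, -a/2, 1). So the set S of the shifts that occur has q elements, and
    [blokhuis_nonsquare] applies to it. *)
Lemma parabola_shifts_behs V :
  inscribed V (parabola_shift 0) ->
  (forall x, x \in V -> exists a,
     inscribed V (parabola_shift a) /\ isotropic (parabola_shift a) x) ->
  #|V| = (#|F|.-1 * (q ^ 3 + 1))%N -> #|line_vectors V (row3 0 0 1)| = #|F|.-1 ->
  exists2 t, nsq n t & forall x, (x \in V) =
    (x != 0) && [exists s in GFq F q, 2 * x 0 1 * x 0 2 - x 0 0 ^+ 2 + t * s * x 0 2 ^+ 2 == 0].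
Proof.
move=> ins0 coverV cardV cardL.
pose top a : 'rV[F]_3 := row3 0 (- a / 2) 1.
have top_shift a b : isotropic (parabola_shift b) (top a) = (b == a).
  rewrite isotropic_parabola_shift !row3E row3_neq0 ?oner_neq0 ?orbT //=.
  rewrite (_ : _ + _ = b - a); last by field.
  by rewrite subr_eq0.
pose S := [set a | top a \in V].
have insS a : a \in S -> inscribed V (parabola_shift a).
  by rewrite inE => /coverV[b [insb]]; rewrite top_shift => /eqP<-.
have Sins a : inscribed V (parabola_shift a) -> a \in S.
  by move=> [_ _ _ inV _]; rewrite inE inV // top_shift.
have S0 : 0 \in S by apply: Sins.
have nsqS : nsq_differences n S.
  move=> a b aS bS neq_ab.
  have := inscribed_nsq cardF n_even (insS a aS) (w := top b).
  rewrite det_parabola_shift mulr1 bil_parabola_shift !row3E.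
  rewrite (_ : _ + _ = a - b); last by field.
  by apply; rewrite ?subr_eq0 //; move: bS; rewrite inE.
have inVE x : (x \in V) = (x != 0) &&
    [exists a in S, 2 * x 0 1 * x 0 2 - x 0 0 ^+ 2 + a * x 0 2 ^+ 2 == 0].
  apply/idP/andP => [/coverV[a [insa]] | [x0 /existsP[a /andP[aS ax]]]].
    rewrite isotropic_parabola_shift => /andP[x0 ax]; split=> //.
    by apply/existsP; exists a; rewrite Sins.
  have [_ _ _ inV _] := insS a aS; apply: inV.
  by rewrite isotropic_parabola_shift x0.
have cardS : #|S| = q.
  (* the vectors off the line z = 0 are parametrized by the conic, x/z and z *)
  pose pt (b : F * F * F) : 'rV[F]_3 := b.2 *: row3 b.1.2 ((b.1.2 ^+ 2 - b.1.1) / 2) 1.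
  pose D := setX (setX S [set: F]) [set~ (0 : F)].
  have ptE b : (pt b 0 0 = b.2 * b.1.2) *
      (pt b 0 1 = b.2 * ((b.1.2 ^+ 2 - b.1.1) / 2)) * (pt b 0 2 = b.2).
    by rewrite !mxE /= mulr1.
  have pt_inj : {in D &, injective pt}.
    move=> [[a x] z] [[a' x'] z']; rewrite !inE /= => /andP[_ z0] _ /rowP e.
    have := e 2; have := e 1; have := e 0; rewrite !ptE /= => e0 e1 e2.
    rewrite -e2 in e0 e1 *; have ex := mulfI z0 e0; have := mulfI z0 e1.
    by rewrite -ex => /(mulIf (invr_neq0 two0)) /addrI /oppr_inj ->.
  have VD : V :\: line_vectors V (row3 0 0 1) = pt @: D.
    have lineE (x : 'rV[F]_3) : (x *m (row3 0 0 1)^T == 0) = (x 0 2 == 0).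
      apply/eqP/eqP => [/matrixP/(_ 0 0) | x2].
        by rewrite mxE sum_ord3 !mxE /= !mulr0 !add0r mulr1.
      by apply/matrixP => i j; rewrite [i]ord1 [j]ord1 mxE sum_ord3 !mxE /= !mulr0 !add0r mulr1.
    apply/setP => x; rewrite in_setD [x \in line_vectors _ _]inE lineE.
    apply/idP/imsetP => [/andP[+ xV] | [[[a s] z]]].
      rewrite xV /= => x2; move: xV.
      rewrite inVE => /andP[x0 /existsP[a /andP[aS /eqP ax]]].
      exists (a, x 0 0 / x 0 2, x 0 2).
        by rewrite in_setX /= in_setX /= aS in_setT in_setC1 x2.
      apply: row3P; rewrite ptE /=; [by field | | by []].
      apply: (mulfI two0); apply: (mulIf x2).
      have -> : 2 * x 0 1 * x 0 2 = x 0 0 ^+ 2 - a * x 0 2 ^+ 2.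
        by apply/eqP; rewrite -subr_eq0 -ax; apply/eqP; ring.
      by field; rewrite x2 two0.
    rewrite in_setX /= in_setX /= in_setC1 => /andP[/andP[aS _] z0] ->.
    rewrite !ptE /= (negPf z0) andbF /= inVE; apply/andP; split.
      by apply: contra_neq z0 => /rowP/(_ 2); rewrite ptE mxE.
    by apply/existsP; exists a; rewrite aS !ptE /=; apply/eqP; field.
  have := cardsD V (line_vectors V (row3 0 0 1)).
  rewrite (setIidPr _); last by apply/subsetP => x; rewrite inE => /andP[].
  rewrite VD (card_in_imset pt_inj) !cardsX cardsT cardsC1 cardV cardL => e.
  have d0 : (0 < #|F|.-1)%N by rewrite cardF; clear -n_ge4; lia.
  have q0 : (0 < q ^ 2)%N by rewrite -cardFq cardF.
  have : (#|S| * #|F| * #|F|.-1 = q * #|F| * #|F|.-1)%N.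
    by rewrite e mulnDr muln1 addnK cardFq mulnC -expnS.
  move/eqP; rewrite eqn_pmul2r // cardFq eqn_pmul2r // => /eqP //.
have [t nsqt SE] := blokhuis_nonsquare cardF cardFq qE m_gt0 frobD S0 cardS nsqS.
exists t => // x; rewrite inVE SE; congr (_ && _).
apply/existsP/existsP => [[a /andP[/imsetP[s sq ->] e]] | [s /andP[sq e]]].
  by exists s; rewrite sq.
by exists (t * s); rewrite e andbT; apply/imsetP; exists s.
Qed.

(** With the parabola for one of the conics, and its point on the common double line
    at infinity, that line becomes z = 0 and all conics become shifts. *)
Theorem covered_behs V : unital_cone q V -> covered V ->
  exists2 t : F, nonsquare t & exists2 M, M \in unitmx & forall x, (x *m M \in V) =
    (x != 0) && [exists s in GFq F q, 2 * x 0 1 * x 0 2 - x 0 0 ^+ 2 + t * s * x 0 2 ^+ 2 == 0].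
Proof.
move=> [V0 _ cardV lines] coverV.
have [w0 w0V] : exists w, w \in V.
  by apply/card_gt0P; rewrite cardV muln_gt0 addn1 cardF /= andbT; clear -n_ge4; lia.
have [A [insA _]] := coverV w0 w0V.
have [v [v0 pencil]] := common_pencil cardF n_even n_ge4 cardFq q_ge3 two_sqr insA coverV cardV.
have isoL x : x \in line_vectors V v -> isotropic A x.
  rewrite inE => /andP[/coverV[B [/pencil[c [e [c0 BE]]] /andP[x0 xx]]] /eqP xv].
  move: xx; rewrite BE bil_add !bil_scale bil_tensor xv mxE mul0r mulr0 addr0.
  rewrite mulf_eq0 (negPf c0) /= => xx.
  by rewrite /isotropic x0.
have [p isop Lp] := pencil_line_scalings V0 insA v0 isoL (lines v v0).
have [k k0 pA] := tangent_of_scalings insA isop Lp.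
have [symA unitA _ _ _] := insA.
have [M [d [unitM d0 rM MA]]] := parabola_form two0 symA unitA isop.
have vM : v *m M^T = (d / k) *: row3 0 0 1.
  apply: (scalerI k0); rewrite scalemxAl -pA -rM -!row_mul MA scalerA mulrC divfK //.
  by apply: row3P; rewrite !mxE /=; ring.
have shift B : inscribed V B -> exists c a : F,
    [/\ c != 0, M *m B *m M^T = c *: parabola_shift a &
       inscribed [set x | x *m M \in V] (parabola_shift a)].
  move=> insB; have [c [e [c0 BE]]] := pencil _ insB.
  have MB : M *m B *m M^T = (c * d) *: parabola_shift (e * d / (c * k ^+ 2)).
    rewrite BE mulmxDr mulmxDl -!scalemxAr -!scalemxAl MA.
    rewrite (_ : M *m (v^T *m v) *m M^T = (v *m M^T)^T *m (v *m M^T)); last first.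
      by rewrite trmx_mul trmxK !mulmxA.
    rewrite vM; apply/matrixP => i j; rewrite !mxE !big_ord1 !mxE.
    by field; rewrite c0 k0.
  exists (c * d), (e * d / (c * k ^+ 2)); split=> //; first by rewrite mulf_neq0.
  have cd0 : c * d != 0 by rewrite mulf_neq0.
  have := inscribed_scale (invr_neq0 cd0) (inscribed_mulmx unitM insB).
  by rewrite MB scalerA mulVf // scale1r.
have [|x|||t nsqt tE] := @parabola_shifts_behs [set x | x *m M \in V].
- have := inscribed_scale (invr_neq0 d0) (inscribed_mulmx unitM insA).
  by rewrite MA scalerA mulVf // scale1r /parabola_shift scale0r addr0.
- rewrite inE => /coverV[B [insB isoB]]; have [c [a [c0 MB insa]]] := shift B insB.
  exists a; split=> //.
  by rewrite -(isotropic_scale _ _ c0) -MB isotropic_mulmx.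
- by rewrite card_mulmx.
- have <- : [set x | x *m M \in line_vectors V v] =
      line_vectors [set x | x *m M \in V] (row3 0 0 1).
    apply/setP => x; rewrite !inE -mulmxA; congr (_ && _).
    have -> : M *m v^T = (d / k) *: (row3 0 0 1)^T.
      by rewrite -linearZ /= -vM trmx_mul trmxK.
    by rewrite -scalemxAr scaler_eq0 mulf_eq0 invr_eq0 (negPf d0) (negPf k0).
  by rewrite card_mulmx // Lp card_scalings // (andP isop).1.
exists t; first by move=> [s ts]; move: nsqt; rewrite ts (nsq_sqr cardF).
exists M => // x.
by have := tE x; rewrite inE.
Qed.

End OddOrder.

(** * From points and polynomials to vectors and matrices *)

Section PointVectors.
Local Open Scope ring_scope.
Variable F : finFieldType.
Implicit Types (v x : 'rV[F]_3) (P : point F) (U : {set point F}).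

Definition vec P : 'rV[F]_3 := vpick P.

Lemma vec_neq0 P : vec P != 0.
Proof. by rewrite vpick0 -dimv_eq0 (eqP (valP P)). Qed.

Lemma vec_mem P : vec P \in (P : {vspace _}). Proof. exact: memv_pick. Qed.

Lemma point_spanned P v : v != 0 -> v \in (P : {vspace _}) -> (P : {vspace _}) = <[v]>%VS.
Proof.
by move=> v0 vP; apply/esym/eqP; rewrite eqEdim -memvE vP dim_vline v0 (eqP (valP P)).
Qed.

Lemma point_eq P P' v : v != 0 -> v \in (P : {vspace _}) -> v \in (P' : {vspace _}) -> P = P'.
Proof.
by move=> v0 vP vP'; apply: val_inj; rewrite /= (point_spanned v0 vP) (point_spanned v0 vP').
Qed.

Definition vecs U : {set 'rV[F]_3} :=
  [set v | (v != 0) && [exists P in U, v \in (P : {vspace _})]].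

Lemma vecsP U P v : v != 0 -> v \in (P : {vspace _}) -> (v \in vecs U) = (P \in U).
Proof.
move=> v0 vP; rewrite inE v0 /=; apply/existsP/idP => [[P' /andP[P'U vP']] | PU].
  by rewrite (point_eq v0 vP vP').
by exists P; rewrite PU.
Qed.

Lemma vecs_vec U P : (vec P \in vecs U) = (P \in U).
Proof. by apply: vecsP; [apply: vec_neq0 | apply: vec_mem]. Qed.

Lemma vecs_inj U U' : vecs U = vecs U' -> U = U'.
Proof. by move=> /setP e; apply/setP => P; have := e (vec P); rewrite !vecs_vec. Qed.

Lemma card_vecs U : #|vecs U| = (#|F|.-1 * #|U|)%N.
Proof.
pose f (b : point F * F) : 'rV[F]_3 := b.2 *: vec b.1.
have inP P k : k *: vec P \in (P : {vspace _}) by rewrite memvZ // vec_mem.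
have fN0 P k : k != 0 -> k *: vec P != 0 by move=> k0; rewrite scaler_eq0 negb_or k0 vec_neq0.
have f_inj : {in setX U [set~ 0] &, injective f}.
  move=> [P k] [P' k']; rewrite !in_setX !in_setC1 /= => /andP[_ k0] /andP[_ k'0].
  rewrite /f /= => e; have PP' : P = P'.
    by apply: (@point_eq _ _ (k *: vec P)); rewrite ?fN0 // e.
  move: e; rewrite PP' => /eqP; rewrite -subr_eq0 -scalerBl scaler_eq0.
  by rewrite (negPf (vec_neq0 _)) orbF subr_eq0 => /eqP->.
rewrite mulnC -(cardsC1 (0 : F)) -cardsX -(card_in_imset f_inj); congr #|pred_of_set _|.
apply/setP => v; apply/idP/imsetP => [| [[P k]]].
  rewrite inE => /andP[v0 /existsP[P /andP[PU vP]]].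
  have := vP; rewrite (point_spanned (vec_neq0 P) (vec_mem P)) => /vlineP[k vE].
  exists (P, k) => //.
  by rewrite in_setX PU in_setC1 /=; apply: contra_neq v0 => k0; rewrite vE k0 scale0r.
rewrite in_setX in_setC1 /= => /andP[PU k0] ->.
by rewrite (@vecsP _ P) ?fN0 ?inP.
Qed.

Fact covector_line_subproof v : v != 0 ->
  \dim (lker (linfun (mulmxr v^T : 'rV[F]_3 -> 'M_1))) == 2%N.
Proof.
move=> v0; set f := linfun _.
have := limg_ker_dim f fullv; rewrite capfv dimvf -[RHS]/(2 + 1)%N => e.
suff f1 : \dim (limg f) = 1%N by move/eqP: e; rewrite f1 eqn_add2r.
apply/eqP; rewrite eqn_leq; apply/andP; split.
  by have := dimvS (subvf (limg f)); rewrite dimvf.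
rewrite lt0n dimv_eq0; apply/eqP => f0.
case/rV0Pn: v0 => j; case/eqP.
have : f (delta_mx 0 j) \in limg f by rewrite memv_img ?memvf.
by rewrite f0 memv0 lfunE /= -rowE => /eqP/matrixP/(_ 0 0); rewrite !mxE.
Qed.

Lemma vecs_unital_cone q U : unital q U -> unital_cone q (vecs U).
Proof.
move=> [cardU lines]; split; first by rewrite inE eqxx.
- move=> k v k0; rewrite !inE scaler_eq0 (negPf k0) /=; congr (_ && _).
  by apply: eq_existsb => P; rewrite rpredZeq (negPf k0).
- by rewrite card_vecs cardU.
move=> v v0; pose L := Line (covector_line_subproof v0).
have -> : line_vectors (vecs U) v = vecs (U :&: line_points L).
  apply/setP => x; rewrite !inE; apply/andP/andP.
    move=> [/andP[x0 /existsP[P /andP[PU xP]]] xv]; split=> //; apply/existsP; exists P.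
    by rewrite xP andbT !inE PU /= (point_spanned x0 xP) -memvE memv_ker lfunE.
  move=> [x0 /existsP[P /andP[]]]; rewrite !inE => /andP[PU PL] xP; split.
    by rewrite x0; apply/existsP; exists P; rewrite PU.
  by have /subvP/(_ _ xP) := PL; rewrite memv_ker lfunE.
by rewrite card_vecs; case: (lines L) => ->; [left; rewrite muln1 | right].
Qed.

Lemma vecs_collineation (U : {set point F}) (g : {'GL_3[F]}) x :
  (x \in vecs [set collineation g P | P in U]) = (x *m invmx (val g) \in vecs U).
Proof.
have unitg : val g \in unitmx := GL_unitmx g.
rewrite !inE; have -> : (x *m invmx (val g) != 0) = (x != 0).
  congr (~~ _); apply/eqP/eqP => [e | ->]; last by rewrite mul0mx.
  by rewrite -(mulmxKV unitg x) e mul0mx.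
congr (_ && _).
have memg P : (x \in (collineation g P : {vspace _})) = (x *m invmx (val g) \in (P : {vspace _})).
  apply/memv_imgP/idP => [[y yP ->] | xP].
    by rewrite lfunE /= mulmxK.
  by exists (x *m invmx (val g)) => //; rewrite lfunE /= mulmxKV.
apply/existsP/existsP => [[_ /andP[/imsetP[P PU ->]]] | [P /andP[PU]]].
  by rewrite memg => xP; exists P; rewrite PU.
by rewrite -memg => xP; exists (collineation g P); rewrite xP andbT imset_f.
Qed.

End PointVectors.

Section QuadraticPolynomials.
Local Open Scope ring_scope.
Variable F : finFieldType.
Implicit Types (N : 'M[F]_3) (Q : {mpoly F[3]}) (v x : 'rV[F]_3) (P : point F).

Definition quadratic_poly N : {mpoly F[3]} := \sum_i \sum_j N i j *: ('X_i * 'X_j).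

Lemma quadratic_polyP Q : Q \is 2.-homog -> exists N, Q = quadratic_poly N.
Proof.
move/dhomogP => homQ.
have repD N N' : quadratic_poly (N + N') = quadratic_poly N + quadratic_poly N'.
  rewrite /quadratic_poly -big_split; apply: eq_bigr => i _ /=.
  by rewrite -big_split; apply: eq_bigr => j _ /=; rewrite mxE scalerDl.
have repZ k N : quadratic_poly (k *: N) = k *: quadratic_poly N.
  rewrite /quadratic_poly scaler_sumr; apply: eq_bigr => i _.
  by rewrite scaler_sumr; apply: eq_bigr => j _; rewrite mxE scalerA.
have rep0 : quadratic_poly 0 = 0.
  by apply: big1 => i _; apply: big1 => j _; rewrite mxE scale0r.
have repX i j : quadratic_poly (delta_mx i j) = 'X_i * 'X_j.
  rewrite /quadratic_poly (bigD1 i) //= (bigD1 j) //= mxE !eqxx scale1r.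
  rewrite !big1 ?addr0 // => [k ki | k kj].
    by apply: big1 => l _; rewrite mxE (negPf ki) scale0r.
  by rewrite mxE eqxx (negPf kj) scale0r.
rewrite [Q]mpolyE big_seq; elim/big_ind: _ => [|p p' [N ->] [N' ->] | m mQ].
- by exists 0.
- by exists (N + N').
have [i [j mE]] : exists i j, m = (U_(i) + U_(j))%MM.
  have mdeg2 : mdeg m = 2%N by apply: homQ.
  have [i mi] : exists i, (0 < m i)%N.
    apply/existsP/contraT => /existsPn m0; move: mdeg2; rewrite mdegE big1 // => i _.
    by apply/eqP; rewrite -leqn0 leqNgt.
  have subK : (m - U_(i) + U_(i))%MM = m by rewrite submK // lep1mP -lt0n.
  have /mdeg1P[j /eqP jE] : mdeg (m - U_(i))%MM == 1%N.
    by have := mdegD (m - U_(i))%MM U_(i); rewrite subK mdeg1 mdeg2 addn1 => -[<-].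
  by exists j, i; rewrite -jE subK.
by exists (Q@_m *: delta_mx i j); rewrite repZ repX mE mpolyXD.
Qed.

Lemma meval_quadratic_poly N v : (quadratic_poly N).@[v 0] = bil N v v.
Proof.
rewrite /quadratic_poly raddf_sum /bil mxE /=.
under [RHS]eq_bigr => j _ do rewrite !mxE big_distrl /=.
rewrite [RHS]exchange_big /=; apply: eq_bigr => i _.
rewrite raddf_sum; apply: eq_bigr => j _ /=.
by rewrite mevalZ mevalM !mevalXU mulrCA mulrA.
Qed.

Lemma meval_deriv_quadratic_poly N v k :
  ((quadratic_poly N)^`M(k)).@[v 0] = (v *m polar N) 0 k.
Proof.
have derivX (i l : 'I_3) : (('X_i : {mpoly F[3]})^`M(l)).@[v 0] = (i == l)%:R.
  rewrite mderivX mevalZ mnm1E; case: eqP => [->|_]; last by rewrite mul0r.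
  by rewrite mul1r -[X in (X - _)%MM]add0m addmK mpolyX0 meval1.
rewrite /quadratic_poly (raddf_sum (mderiv k)) raddf_sum /= /polar mulmxDr mxE.
transitivity (\sum_i \sum_j
    (N i j * ((i == k)%:R * v 0 j) + N i j * (v 0 i * (j == k)%:R))).
  apply: eq_bigr => i _; rewrite (raddf_sum (mderiv k)) raddf_sum; apply: eq_bigr => j _ /=.
  by rewrite mderivZ mevalZ mderivM mevalD !mevalM !mevalXU !derivX mulrDr.
under eq_bigr => i _ do rewrite big_split /=.
rewrite big_split /= addrC; congr (_ + _).
  rewrite mxE; apply: eq_bigr => i _.
  rewrite (bigD1 k) //= eqxx mulr1 big1 ?addr0 => [|j /negPf->]; first by rewrite mulrC.
  by rewrite !mulr0.
rewrite exchange_big /= mxE; apply: eq_bigr => j _.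
rewrite (bigD1 k) //= eqxx mul1r big1 ?addr0 => [|i /negPf->]; first by rewrite mxE mulrC.
by rewrite mul0r mulr0.
Qed.

Lemma nonsingular_quadratic_poly N : nonsingular (quadratic_poly N) -> nondegenerate N.
Proof.
move=> nsQ v vv vS; have mapQ : map_mpoly idfun (quadratic_poly N) = quadratic_poly N.
  by apply/mpolyP => m; rewrite mcoeff_map_mpoly.
apply: (nsQ F idfun); rewrite mapQ ?meval_quadratic_poly // => i.
by rewrite meval_deriv_quadratic_poly vS mxE.
Qed.

Lemma zero_locus_quadratic_poly N P v : v != 0 -> v \in (P : {vspace _}) ->
  (P \in zero_locus (quadratic_poly N)) = (bil N v v == 0).
Proof.
move=> v0 vP; rewrite inE; apply/forallP/idP => [/(_ v)|vv w].
  by rewrite vP /= meval_quadratic_poly.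
apply/implyP; rewrite (point_spanned v0 vP) => /vlineP[k ->].
by rewrite meval_quadratic_poly bilZl bilZr (eqP vv) !mulr0.
Qed.

Lemma union_of_conics_vecs (U : {set point F}) : union_of_irreducible_conics U ->
  forall v, v \in vecs U -> exists N,
    [/\ nondegenerate N, forall x, isotropic N x -> x \in vecs U & isotropic N v].
Proof.
move=> [S [irrS UE]] v; rewrite inE => /andP[v0 /existsP[P /andP[]]].
rewrite UE => /bigcupP[C CS PC] vP.
have [Q [_ /quadratic_polyP[N ->] nsQ CE]] := irrS C CS.
exists N; split; first exact: nonsingular_quadratic_poly.
  move=> x /andP[x0 xx].
  have dimx : \dim <[x]>%VS == 1%N by rewrite dim_vline x0.
  rewrite (@vecsP _ _ (Point dimx)) //; last exact: memv_line.
  apply/bigcupP; exists C => //.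
  by rewrite CE (@zero_locus_quadratic_poly _ _ x) //; exact: memv_line.
by rewrite /isotropic v0 -(@zero_locus_quadratic_poly _ P) // -CE.
Qed.

Lemma vecs_behs q t x : (x \in vecs (behs q t)) =
  (x != 0) && [exists s in GFq F q, 2 * x 0 1 * x 0 2 - x 0 0 ^+ 2 + t * s * x 0 2 ^+ 2 == 0].
Proof.
have [-> | x0] := eqVneq x 0; first by rewrite inE eqxx.
have dimx : \dim <[x]>%VS == 1%N by rewrite dim_vline x0.
have xx : x \in (Point dimx : {vspace _}) by apply: memv_line.
rewrite (vecsP _ x0 xx) /=.
have conicE a : (Point dimx \in zero_locus (conic_poly a)) =
    (2 * x 0 1 * x 0 2 - x 0 0 ^+ 2 + a * x 0 2 ^+ 2 == 0).
  have evalE (v : 'rV_3) : (conic_poly a).@[v 0] = 2 * v 0 1 * v 0 2 - v 0 0 ^+ 2 + a * v 0 2 ^+ 2.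
    by rewrite /conic_poly mevalD mevalB !mevalZ mevalM !rmorphXn /= !mevalXU mulrA.
  rewrite inE; apply/forallP/eqP => [/(_ x)|ax v].
    by rewrite xx evalE => /eqP.
  apply/implyP => /vlineP[k ->]; rewrite evalE !mxE.
  rewrite (_ : _ + _ = k ^+ 2 * (2 * x 0 1 * x 0 2 - x 0 0 ^+ 2 + a * x 0 2 ^+ 2)); last by ring.
  by rewrite ax mulr0.
apply/bigcupP/existsP => [[a /imsetP[s sq ->]] | [s /andP[sq]]].
  by rewrite conicE => e; exists s; rewrite sq.
by rewrite -conicE => e; exists (t * s) => //; apply: imset_f.
Qed.

End QuadraticPolynomials.

Theorem theorem1p1 (p h q : nat) (F : finFieldType) (U : {set point F}) :
  prime p -> 0 < h -> q = p ^ h -> #|F| = q ^ 2 ->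
  unital q U ->
  union_of_irreducible_conics U ->
  odd q /\
  exists t : F, nonsquare t /\
    exists g : {'GL_3[F]}, [set collineation g P | P in U] = behs q t.
Proof.
move=> p_pr h_gt0 qE cardF unitalU conicsU.
have q_gt1 : 1 < q by rewrite qE -(exp1n h) ltn_exp2r // prime_gt1.
have uniV := vecs_unital_cone unitalU; have coverV := union_of_conics_vecs conicsU.
have pcharF : p \in [pchar F]%R by apply: (@card_finPcharP _ _ (h * 2)); rewrite // expnM -qE.
have odd_q : odd q.
  rewrite qE oddX; apply/orP; right; apply/contraT => even_p.
  have p2 : p = 2 by apply/(prime_oddPn p_pr).
  have two0 : (2 = 0 :> F)%R by have /andP[_ /eqP] := pcharF; rewrite p2.
  have [v vV] : exists v, v \in vecs U by have [v vV] := unital_cone_nonempty uniV; exists v.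
  have [N [nsN inV isoN]] := coverV v vV.
  by case: (even_no_conic cardF q_gt1 two0 uniV nsN inV); exists v.
split=> //.
have qm : q = (2 * q./2).+1 by rewrite -[LHS]odd_double_half odd_q -mul2n.
have m_gt0 : 0 < q./2 by move: q_gt1; rewrite {1}qm; case: q./2.
have frobD (x y : F) : ((x + y) ^+ q = x ^+ q + y ^+ q)%R.
  by apply: exprDn_pchar; rewrite qE pnatX (pnatE _ p_pr) pcharF.
have [n Fn] : exists n, #|F| = (2 * n).+1.
  by exists #|F|./2; rewrite -[LHS]odd_double_half cardF oddX odd_q -mul2n.
have covV : covered (vecs U).
  move=> v /coverV[N [nsN inV isov]]; exists (polar N).
  rewrite (isotropic_polar _ _ (two_neq0 Fn)); split=> //.
  by apply: (polar_inscribed cardF q_gt1 (two_neq0 Fn) uniV nsN inV); exists v.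
have [t nst [M unitM VE]] := covered_behs cardF qm m_gt0 frobD uniV covV.
exists t; split=> //.
have unitV : (invmx M \is a GRing.unit)%R by rewrite unitmx_inv.
exists (FinRing.unit 'M[F]_3 unitV); apply: vecs_inj; apply/setP => x.
by rewrite vecs_collineation invmxK VE vecs_behs.
Qed.
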